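(* For all integers $l_1,l_2\ge1$, $|m_1|\le l_1$, $|m_2|\le l_2$ and all $a,b\in\mathbb R$, $$\widehat{MC}\big((e_{l_1m_1},a),(e_{l_2m_2},b)\big)=\sum_{l_3,m_3}\big(g^{l_3\,-m_3}_{l_1m_1l_2m_2}\big)^2\big(l_1(l_1+1)-l_3(l_3+1)\big)-m_1^2\,\delta^{m_1}_{m_2}\delta^{l_1}_{l_2}+(-1)^{m_2}a\,m_2\,g^{l_2\,-m_2}_{l_1m_1l_2m_2},$$ where the sum is over all $l_3\ge 0$ and $-l_3\le m_3\le l_3$ (only finitely many terms are nonzero).
   Context: Use coordinates $(\lambda,\mu)\in(0,2\pi)\times(-1,1)$ on the unit sphere $\mathbb S^2$ ($\lambda$ longitude, $\mu$ height), with area element $d\lambda\,d\mu$ and Laplace–Beltrami operator $\Delta$. The Poisson bracket is $\{f,g\}=\partial_\lambda f\,\partial_\mu g-\partial_\mu f\,\partial_\lambda g$, extended complex-bilinearly to complex-valued functions, and $\langle f,g\rangle=\int_{\mathbb S^2} f\,g^*\,d\lambda\,d\mu$, where $^*$ is complex conjugation. For integers $l\ge 0$, $|m|\le l$, $Y_{lm}$ denotes the complex spherical harmonic: for $m\ge 0$, $Y_{lm}=(-1)^m\sqrt{\frac{2l+1}{4\pi}\frac{(l-m)!}{(l+m)!}}\,P_l^m(\mu)e^{im\lambda}$ with $P_l^m(\mu)=\frac{(1-\mu^2)^{m/2}}{2^l l!}\frac{d^{l+m}}{d\mu^{l+m}}(\mu^2-1)^l$, and $Y_{l\,-m}=(-1)^mY_{lm}^*$.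 These are orthonormal with $\Delta Y_{lm}=-l(l+1)Y_{lm}$. Put $\nabla^\perp f=(-\partial_\mu f,\partial_\lambda f)$ and $e_{lm}=\nabla^\perp Y_{lm}$. For $u=\nabla^\perp f$, $v=\nabla^\perp g$ and $a,b\in\mathbb R$, the Misiolek criterion in the presence of the Coriolis force is $$\widehat{MC}((u,a),(v,b))=\langle\Delta\{f,g\},\{f,g\}\rangle-\langle\{\Delta f,g\},\{f,g\}\rangle-|\langle\{\mu,f\},g\rangle|^2-a\,\langle\{\mu,\{f,g\}\},g\rangle .$$ Structure constants: $\{Y_{l_1m_1},Y_{l_2m_2}\}=\sum_{l_3,m_3}G^{l_3m_3}_{l_1m_1l_2m_2}Y_{l_3m_3}$, and the real structure constants $g$ are defined by $G^{l_3m_3}_{l_1m_1l_2m_2}=-\mathrm i(-1)^{m_3}g^{l_3\,-m_3}_{l_1m_1l_2m_2}$. $\delta$ is the Kronecker delta. *)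

(* Defs.v *)
From HB Require Import structures.
From mathcomp Require Import all_boot all_order all_algebra.
From mathcomp Require Import complex.
From mathcomp Require Import all_classical all_reals all_analysis.
Set Implicit Arguments.
Unset Strict Implicit.
Unset Printing Implicit Defensive.
Import Order.TTheory GRing.Theory Num.Theory.
Import numFieldNormedType.Exports.
Local Open Scope classical_set_scope.
Local Open Scope ring_scope.
Local Open Scope complex_scope.

(* A point p : R * R stands for (lambda, mu) = (p.1, p.2). Functions and vector
   fields on the sphere are represented by total functions on R * R, of which
   only the values on the chart matter. *)
Definition chart (R : realType) : set (R * R) :=
  `]0, 2 * pi[ `*` `](- 1), 1[.

Definition cderivable (R : realType) (h : R -> R[i]) (x : R) : Prop :=
  derivable (fun t => complex.Re (h t)) x 1 /\
  derivable (fun t => complex.Im (h t)) x 1.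

Definition cderive1 (R : realType) (h : R -> R[i]) (x : R) : R[i] :=
  derive1 (fun t => complex.Re (h t)) x
  +i* derive1 (fun t => complex.Im (h t)) x.

Definition dlambda (R : realType) (f : R * R -> R[i]) (p : R * R) : R[i] :=
  cderive1 (fun t => f (t, p.2)) p.1.

Definition dmu (R : realType) (f : R * R -> R[i]) (p : R * R) : R[i] :=
  cderive1 (fun t => f (p.1, t)) p.2.

Definition mu_coord (R : realType) (p : R * R) : R[i] := p.2%:C.

(* The round metric is dmu^2 / (1 - mu^2) + (1 - mu^2) dlambda^2. *)
Definition laplacian (R : realType) (f : R * R -> R[i]) (p : R * R) : R[i] :=
  dmu (fun q => (1 - q.2 ^+ 2)%:C * dmu f q) p
  + dlambda (dlambda f) p / (1 - p.2 ^+ 2)%:C.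

Definition poisson (R : realType) (f g : R * R -> R[i]) (p : R * R) : R[i] :=
  dlambda f p * dmu g p - dmu f p * dlambda g p.

Definition sphere_integral (R : realType) (f : R * R -> R[i]) : R[i] :=
  let area := (@lebesgue_measure R \x @lebesgue_measure R)%E in
  Rintegral area (@chart R) (fun p => complex.Re (f p))
  +i* Rintegral area (@chart R) (fun p => complex.Im (f p)).

Definition inner (R : realType) (f g : R * R -> R[i]) : R[i] :=
  sphere_integral (fun p => f p * conjc (g p)).

Definition perp_grad (R : realType) (f : R * R -> R[i]) (p : R * R) :
    R[i] * R[i] :=
  (- dmu f p, dlambda f p).

Definition is_stream_function (R : realType) (u : R * R -> R[i] * R[i])
    (f : R * R -> R[i]) : Prop :=
  forall p, chart p ->
    [/\ cderivable (fun t => f (t, p.2)) p.1,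
        cderivable (fun t => f (p.1, t)) p.2 &
        perp_grad f p = u p].

(* Some f with u = perp_grad f; it is determined on the chart up to an additive
   constant. *)
Definition stream_function (R : realType) (u : R * R -> R[i] * R[i]) :
    R * R -> R[i] :=
  xget (fun=> 0) [set f | is_stream_function u f].

(* The second Coriolis component b does not occur in the formula. *)
Definition misiolek_coriolis (R : realType)
    (ua vb : (R * R -> R[i] * R[i]) * R) : R[i] :=
  let f := stream_function ua.1 in
  let g := stream_function vb.1 in
  let a := ua.2 in
  inner (laplacian (poisson f g)) (poisson f g)
  - inner (poisson (laplacian f) g) (poisson f g)
  - `|inner (poisson (@mu_coord R) f) g| ^+ 2
  - a%:C * inner (poisson (@mu_coord R) (poisson f g)) g.

Definition assoc_legendre (R : realType) (l m : nat) (x : R) : R :=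
  (1 - x ^+ 2) `^ (m%:R / 2) / (2 ^+ l * l`!%:R)
  * derive1n (l + m) (fun y : R => (y ^+ 2 - 1) ^+ l) x.

Definition cis (R : realType) (x : R) : R[i] := cos x +i* sin x.

Definition sph_harm_nat (R : realType) (l m : nat) (p : R * R) : R[i] :=
  ((- 1) ^+ m
   * Num.sqrt ((2 * l + 1)%:R / (4 * pi) * ((l - m)`!%:R / (l + m)`!%:R))
   * assoc_legendre l m p.2)%:C * cis (m%:R * p.1).

(* Negz n is the integer - n.+1. *)
Definition sph_harm (R : realType) (l : nat) (m : int) (p : R * R) : R[i] :=
  match m with
  | Posz n => sph_harm_nat l n p
  | Negz n => (- 1) ^+ n.+1 * conjc (sph_harm_nat l n.+1 p)
  end.

Definition sph_field (R : realType) (l : nat) (m : int) :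
    R * R -> R[i] * R[i] :=
  perp_grad (@sph_harm R l m).

Definition harm_index : set (nat * int) := [set k | (`|k.2| <= k.1)%N].

(* The sum \sum_(k \in A) is 0 by convention when the support is infinite, hence
   the explicit finiteness clause. *)
Definition is_structure_const (R : realType) (l1 : nat) (m1 : int) (l2 : nat)
    (m2 : int) (G : nat -> int -> R[i]) : Prop :=
  finite_set [set k | harm_index k /\ G k.1 k.2 != 0] /\
  forall p, chart p ->
    poisson (@sph_harm R l1 m1) (@sph_harm R l2 m2) p =
    \sum_(k \in harm_index) G k.1 k.2 * @sph_harm R k.1 k.2 p.

(* structure_const l1 m1 l2 m2 l3 m3 is G^{l3 m3}_{l1 m1 l2 m2}. *)
Definition structure_const (R : realType) (l1 : nat) (m1 : int) (l2 : nat)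
    (m2 : int) : nat -> int -> R[i] :=
  xget (fun _ _ => 0) [set G | is_structure_const l1 m1 l2 m2 G].

Definition is_real_structure_const (R : realType) (l1 : nat) (m1 : int)
    (l2 : nat) (m2 : int) (g : nat -> int -> R) : Prop :=
  forall (l3 : nat) (m3 : int), (`|m3| <= l3)%N ->
    @structure_const R l1 m1 l2 m2 l3 m3
    = - 'i%C * (- 1) ^ m3 * (g l3 (- m3))%:C.

(* real_structure_const l1 m1 l2 m2 l3 m is g^{l3 m}_{l1 m1 l2 m2}. *)
Definition real_structure_const (R : realType) (l1 : nat) (m1 : int) (l2 : nat)
    (m2 : int) : nat -> int -> R :=
  xget (fun _ _ => 0) [set g | is_real_structure_const l1 m1 l2 m2 g].

(* Main.v *)
Require Import Defs.
From mathcomp Require Import all_boot all_order all_algebra.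
From mathcomp Require Import complex.
From mathcomp Require Import ring lra zify finmap.
From mathcomp Require Import all_classical all_reals all_analysis.
From mathcomp Require Import measurable_realfun.
Set Implicit Arguments.
Unset Strict Implicit.
Unset Printing Implicit Defensive.
Import Order.TTheory GRing.Theory Num.Theory.
Import numFieldNormedType.Exports.
Local Open Scope classical_set_scope.
Local Open Scope ring_scope.
Local Open Scope complex_scope.

(* On the chart every function involved is a constant times F(mu) e^(i m lambda)
   with F(mu) = (1 - mu^2)^(|m|/2) q(mu) and q a real polynomial: the bracket of
   two spherical harmonics is i times such a function with m = m1 + m2, and the
   Laplacian acts on q by a Gegenbauer operator, whose eigenvectors are the
   derivatives of (mu^2 - 1)^l. These span all polynomials and are orthogonal for
   the weight (1 - mu^2)^|m|, so the bracket is a finite sum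
   sum_l i r_l Y_(l m) with r_l real. Hence G^(l m') = i delta(m', m) r_l, and the
   four terms of the criterion are read off by Parseval's identity. A stream
   function is a spherical harmonic plus a constant; the constant only meets
   derivatives in lambda, which have mean zero. *)

(** Stream functions and both families of structure constants are picked by choice, so nothing can
    be evaluated before existence and enough uniqueness are known: a stream function is determined
    up to a constant on the chart, and a structure constant is recovered as an inner product with a
    harmonic. Another obstacle is the factor 1/(1 - mu^2), which enters through the metric and
    through differentiating (1 - mu^2)^(|m|/2); it has to cancel by polynomial identities for the
    class of functions to be stable under the bracket and the Laplacian. No integration by parts
    takes place on the sphere itself: Fubini reduces each pairing to a real integral over (-1, 1),
    where the weight kills the boundary terms. The signs of the result come from solving i r = -i
    (-1)^m g for g: the sum only sees g^2 = r^2, while the Coriolis term is linear in g and keeps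
    the factor (-1)^m2. *)

Section continuous_integral.
Variable R : realType.
Implicit Types (f F : R -> R) (a b : R).

Lemma integrable_itv_continuous f a b (A : set R) : continuous f ->
  measurable A -> A `<=` `[a, b] ->
  lebesgue_measure.-integrable A (EFin \o f).
Proof.
move=> cf mA sA.
apply: (@integrableS _ (measurableTypeR R) R lebesgue_measure `[a, b]%classic A) => //.
apply: continuous_compact_integrable; first exact: segment_compact.
exact: continuous_subspaceT.
Qed.

Lemma itvoo_sub_itvcc a b : `]a, b[ `<=` `[a, b].
Proof. by apply: subset_itv; rewrite bnd_simp. Qed.

Lemma Rintegral_antiderivative f F a b : a < b -> continuous f ->
  (forall x : R, is_derive x 1 F (f x)) ->
  \int[lebesgue_measure]_(x in `]a, b[) f x = F b - F a.
Proof.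
move=> ab cf dF.
have cF : continuous F.
  by move=> x; apply/differentiable_continuous/derivable1_diffP; case: (dF x).
(* The fundamental theorem of calculus is applied on the closed interval; adding the two endpoints
   does not change the integral. *)
rewrite Rintegral_itv_bndo_bndc; last first.
  exact: integrable_itv_continuous (@itvoo_sub_itvcc a b).
rewrite Rintegral_itv_obnd_cbnd; last first.
  by apply: (@integrable_itv_continuous _ a b) => //; apply: subset_itv; rewrite bnd_simp.
rewrite /Rintegral (@continuous_FTC2 _ _ F) //.
- exact: continuous_subspaceT.
- split=> [x _||].
  + by case: (dF x).
  + by apply: cvg_at_right_filter; exact: cF.
  + by apply: cvg_at_left_filter; exact: cF.
- by move=> x _; rewrite derive1E; case: (dF x).
Qed.

End continuous_integral.

(** * Legendre and Gegenbauer polynomials *)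

Section rodrigues.
Variable R : realType.
Implicit Types (p q : {poly R}) (l m k n : nat).

(* 2^l l! (1 - x^2)^(-m/2) P_l^m(x) *)
Definition rodrigues l m : {poly R} := (('X^2 - 1) ^+ l)^`(l + m).

(* Conjugate by (1 - x^2)^(m/2) of the Laplacian acting on functions of the form
   F(mu) e^(i m lambda), see [laplacian_zonal]. *)
Definition gegenbauer_op m p : {poly R} :=
  (1 - 'X^2) * p^`()^`() - (2 * m.+1)%:R * 'X * p^`() - (m * m.+1)%:R * p.

Lemma deriv_natr n : (n%:R : {poly R})^`() = 0.
Proof. by rewrite -polyC_natr derivC. Qed.

Lemma derivX2B1 : ('X^2 - 1 : {poly R})^`() = 2%:R * 'X.
Proof. by rewrite derivB derivXn derivC subr0 expr1 mulr_natl. Qed.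

Let drv := (derivD, derivN, derivM, derivX2B1, deriv_natr, derivX, derivC).

(** This is the first-order equation (X^2 - 1) u' = 2 l X u differentiated k + 1 times. *)
Lemma derivn_ode l k (u := ('X^2 - 1 : {poly R}) ^+ l) :
  ('X^2 - 1) * u^`(k.+2) + (2 * k.+1)%:R * 'X * u^`(k.+1)
  - (2 * l)%:R * 'X * u^`(k.+1) + (k * k.+1)%:R * u^`(k)
  - (2 * l * k.+1)%:R * u^`(k) = 0.
Proof.
have E0 : ('X^2 - 1) * u^`() - (2 * l)%:R * 'X * u = 0.
  rewrite /u; case: l {u} => [|l].
    by rewrite expr0 derivC muln0 mulr0 mul0r mul0r subr0.
  rewrite deriv_exp derivX2B1 /= [_ ^+ l.+1]exprS -mulr_natl natrM; ring.
elim: k => [|k IH].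
  have := congr1 (@deriv R) E0; rewrite deriv0 !drv derivn0 derivn1 derivnS derivn1.
  move=> <-; ring.
have := congr1 (@deriv R) IH; rewrite deriv0 !drv -!derivnS => E.
rewrite -[RHS]E !natrM -!natr1; ring.
Qed.

Lemma gegenbauer_rodrigues l m : (m <= l)%N ->
  gegenbauer_op m (rodrigues l m) = - (l * l.+1)%:R *: rodrigues l m.
Proof.
move=> lm; rewrite /gegenbauer_op /rodrigues -!derivnS.
(* With k = l + m the first-order coefficient is 2(k+1) - 2l = 2(m+1), and the zeroth-order one is
   (k+1)(k-2l) = m(m+1) - l(l+1). *)
have := derivn_ode l (l + m).
set u2 := _^`(_.+2); set u1 := _^`(_.+1); set u0 := _^`(_) => E.
rewrite -[RHS]subr0 -E scaleNr -mul_polyC polyC_natr.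
rewrite !natrM -!natr1 !natrD; ring.
Qed.

Lemma rodrigues_recr l m : rodrigues l m.+1 = (rodrigues l m)^`().
Proof. by rewrite /rodrigues addnS derivnS. Qed.

Lemma coef_size_X2B1_exp l :
  (('X^2 - 1 : {poly R}) ^+ l)`_(2 * l) = 1 /\
  size (('X^2 - 1 : {poly R}) ^+ l) = (2 * l).+1.
Proof.
have mon : ('X^2 - 1 : {poly R}) ^+ l \is monic.
  by apply: monic_exp; rewrite -[1]/(1%:P); apply: monicXnsubC.
have sz : size (('X^2 - 1 : {poly R}) ^+ l) = (2 * l).+1.
  have := size_exp ('X^2 - 1%:P : {poly R}) l; rewrite size_XnsubC// => <-.
  by rewrite prednK// size_poly_gt0 monic_neq0.
by split=> //; rewrite -[(2 * l)%N]/((2 * l).+1.-1) -sz -lead_coefE (monicP mon).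
Qed.

Lemma lead_rodrigues l m : (m <= l)%N ->
  (rodrigues l m)`_(l - m) != 0 /\ (size (rodrigues l m) <= (l - m).+1)%N.
Proof.
move=> lm.
have [b1 sz] := coef_size_X2B1_exp l; split.
  rewrite /rodrigues coef_derivn.
  have -> : (l + m + (l - m) = 2 * l)%N by lia.
  by rewrite b1 pnatr_eq0 -lt0n ffact_gt0; lia.
apply/leq_sizeP => j hj; rewrite coef_derivn nth_default ?mul0rn// sz; lia.
Qed.

(** The polynomial [rodrigues (m + i) m] has degree exactly i, so the leading term of [q] can be
    cancelled by a multiple of one of them, and induction on the size applies. *)
Lemma rodrigues_span m q :
  exists n (h : nat -> R), q = \sum_(i < n) h i *: rodrigues (m + i) m.
Proof.
have [n] := ubnP (size q).
elim: n q => // n IH q; rewrite ltnS => szq.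
case: (leqP (size q) 0) => [|szq0].
  rewrite leqn0 size_poly_eq0 => /eqP ->.
  by exists 0%N, (fun=> 0); rewrite big_ord0.
set d := (size q).-1.
have [] := @lead_rodrigues (m + d) m (leq_addr _ _).
rewrite addKn; set b := rodrigues _ _ => b0 szb.
pose c := q`_d / b`_d.
have [|n' [h E]] := IH (q - c *: b).
  apply: leq_trans szq; rewrite -(prednK szq0) ltnS.
  apply/leq_sizeP => j; rewrite -/d leq_eqVlt => /orP[/eqP <-|dj].
    by rewrite coefB coefZ divfK// subrr.
  rewrite coefB coefZ !nth_default ?mulr0 ?subr0//; first exact: leq_trans szb _.
  by rewrite -(prednK szq0).
(* The induction hypothesis gives no bound on n', hence the maximum; [h] is cut off at n' because
   its values beyond are arbitrary. *)
exists (maxn n' d.+1), (fun i => (if (i < n')%N then h i else 0) + (if i == d then c else 0)).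
under eq_bigr do rewrite scalerDl.
rewrite big_split /= -[LHS](subrK (c *: b)); congr (_ + _).
  rewrite E (big_ord_widen (maxn n' d.+1) (fun i => h i *: rodrigues (m + i) m)) ?leq_maxl//.
  rewrite big_mkcond; apply: eq_bigr => i _; case: ifP => //; by rewrite scale0r.
have dm : (d < maxn n' d.+1)%N by rewrite leq_max leqnn orbT.
rewrite (bigD1 (Ordinal dm)) //= eqxx big1 ?addr0// => i.
by rewrite -val_eqE /= => /negbTE ->; rewrite scale0r.
Qed.

Definition pint p : R := \int[lebesgue_measure]_(x in `](-1), 1[) p.[x].

Lemma pint_integrable p :
  lebesgue_measure.-integrable `](-1), 1[ (EFin \o horner p).
Proof.
apply: integrable_itv_continuous (@itvoo_sub_itvcc R (-1) 1) => //.
exact: continuous_horner.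
Qed.

Lemma pintD p q : pint (p + q) = pint p + pint q.
Proof.
rewrite /pint; under eq_Rintegral do rewrite hornerD.
by apply: RintegralD => //; exact: pint_integrable.
Qed.

Lemma pintZ c p : pint (c *: p) = c * pint p.
Proof.
rewrite /pint; under eq_Rintegral do rewrite hornerZ.
by apply: RintegralZl => //; exact: pint_integrable.
Qed.

Lemma pint_sum n (F : 'I_n -> {poly R}) :
  pint (\sum_(i < n) F i) = \sum_(i < n) pint (F i).
Proof.
apply: (big_morph pint pintD).
by rewrite -(scale0r 0) pintZ mul0r.
Qed.

Lemma pint_deriv p : pint p^`() = p.[1] - p.[-1].
Proof.
rewrite /pint (@Rintegral_antiderivative R (horner p^`()) (horner p))//.
exact: continuous_horner.
Qed.

Definition weighted_int m p q := pint ((1 - 'X^2) ^+ m * p * q).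

Lemma weighted_intC m p q : weighted_int m p q = weighted_int m q p.
Proof. by rewrite /weighted_int -!mulrA [p * q]mulrC. Qed.

Lemma weighted_intZl m c p q :
  weighted_int m (c *: p) q = c * weighted_int m p q.
Proof. by rewrite /weighted_int -pintZ -scalerAr -scalerAl. Qed.

Lemma weighted_intZr m c p q :
  weighted_int m p (c *: q) = c * weighted_int m p q.
Proof. by rewrite weighted_intC weighted_intZl weighted_intC. Qed.

Lemma weighted_int_suml m n (F : 'I_n -> {poly R}) q :
  weighted_int m (\sum_(i < n) F i) q = \sum_(i < n) weighted_int m (F i) q.
Proof. by rewrite /weighted_int mulr_sumr mulr_suml pint_sum. Qed.

(* Integrate the derivative of (1 - x^2)^(m+1) p' q, which vanishes at 1 and -1. *)
Lemma gegenbauer_by_parts m p q :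
  weighted_int m (gegenbauer_op m p) q =
  - weighted_int m.+1 p^`() q^`() - (m * m.+1)%:R * weighted_int m p q.
Proof.
have := pint_deriv ((1 - 'X^2) ^+ m.+1 * p^`() * q).
have d1 : (1 - 'X^2 : {poly R})^`() = - (2%:R * 'X).
  by rewrite derivB derivXn derivC sub0r expr1 mulr_natl.
have -> : ((1 - 'X^2) ^+ m.+1 * p^`() * q)^`() =
   (1 - 'X^2) ^+ m * gegenbauer_op m p * q +
   ((m * m.+1)%:R *: ((1 - 'X^2) ^+ m * p * q) +
   (1 - 'X^2) ^+ m.+1 * p^`() * q^`()).
  rewrite !drv deriv_exp d1 /= /gegenbauer_op -mul_polyC polyC_natr !natrM -!natr1.
  rewrite -mulr_natl -natr1 [_ ^+ m.+1]exprS; ring.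
rewrite !pintD pintZ !hornerM !horner_exp !hornerE sqrrN expr1n subrr !expr0n /= !mul0r subrr.
rewrite /weighted_int => E; lra.
Qed.

Lemma gegenbauer_selfadjoint m p q :
  weighted_int m (gegenbauer_op m p) q = weighted_int m p (gegenbauer_op m q).
Proof.
rewrite [RHS]weighted_intC !gegenbauer_by_parts.
by rewrite (weighted_intC m q) (weighted_intC m.+1 q^`()).
Qed.

(** Both are eigenvectors of a self-adjoint operator, and l(l+1) is injective on natural numbers, so
    the eigenvalues differ. *)
Lemma rodrigues_orthogonal l l' m : (m <= l)%N -> (m <= l')%N -> l != l' ->
  weighted_int m (rodrigues l m) (rodrigues l' m) = 0.
Proof.
move=> ml ml' ll'.
have := gegenbauer_selfadjoint m (rodrigues l m) (rodrigues l' m).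
rewrite !gegenbauer_rodrigues// weighted_intZl weighted_intZr => /eqP.
rewrite -subr_eq0 -mulrBl mulf_eq0 => /orP[|/eqP//].
rewrite opprK addrC subr_eq0 eqr_nat => /eqP E.
by case/eqP: ll'; nia.
Qed.

(** A beta integral. The derivative of X (1 - X^2)^(l+1), which vanishes at both ends, gives (2l+3)
    I_(l+1) = (2l+2) I_l. It serves as the base case m = l of [rodrigues_norm]. *)
Lemma pint_weight l :
  pint ((1 - 'X^2) ^+ l) = 2 ^+ (2 * l).+1 * l`!%:R ^+ 2 / (2 * l).+1`!%:R.
Proof.
elim: l => [|l IH].
  rewrite expr0 -[1]derivX pint_deriv !hornerX muln0 expr1 factS fact0 muln1 expr1n; lra.
have := pint_deriv ('X * (1 - 'X^2) ^+ l.+1).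
have d1 : (1 - 'X^2 : {poly R})^`() = - (2%:R * 'X).
  by rewrite derivB derivXn derivC sub0r expr1 mulr_natl.
have -> : ('X * (1 - 'X^2) ^+ l.+1 : {poly R})^`() =
   (2 * l + 3)%:R *: (1 - 'X^2) ^+ l.+1 + (- (2 * l + 2)%:R) *: (1 - 'X^2) ^+ l.
  rewrite !drv deriv_exp d1 /= scaleNr -!mul_polyC !polyC_natr (natrD _ _ 3) (natrD _ _ 2) natrM.
  rewrite -mulr_natl -natr1 [_ ^+ l.+1]exprS; ring.
rewrite pintD !pintZ IH !hornerM !horner_exp !hornerE.
rewrite ?(sqrrN, expr1n, subrr, expr0n, mulr0, mul0r, subr0) /= => E.
have n3 : (2 * l + 3)%:R != 0 :> R by rewrite pnatr_eq0; lia.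
apply: (mulfI n3); move/(canRL (addrK _)): E; rewrite sub0r => ->.
have -> : (2 * l.+1).+1 = (2 * l).+3 by lia.
have f0 : (2 * l)`!%:R != 0 :> R by rewrite pnatr_eq0 -lt0n fact_gt0.
rewrite !factS !exprS !natrM -!natr1 !natrM; field.
by rewrite f0 /=; have := ler0n R l => l0; repeat (apply/andP; split); apply: lt0r_neq0; lra.
Qed.

Lemma rodrigues_diag l : rodrigues l l = (2 * l)`!%:R.
Proof.
apply/polyP => i; rewrite -polyC_natr coefC coef_derivn.
have [b1 sz] := coef_size_X2B1_exp l.
case: i => [|i] /=; last by rewrite nth_default ?mul0rn// sz; lia.
by rewrite addn0 addnn -mul2n b1 ffactnn.
Qed.

(* Descending induction on m: [rodrigues l l] is constant, and integrating by parts
   turns the norm of [rodrigues l m] into that of its derivative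
   [rodrigues l m.+1]. *)
Lemma rodrigues_norm l m : (m <= l)%N ->
  weighted_int m (rodrigues l m) (rodrigues l m) =
  (l + m)`!%:R / (l - m)`!%:R * (2 ^+ l * l`!%:R) ^+ 2 * (2 / (2 * l + 1)%:R).
Proof.
move=> ml; have [k kl ->] : exists2 k, (k <= l)%N & m = (l - k)%N.
  by exists (l - m)%N; lia.
elim: k kl {m ml} => [_|k IH kl].
  rewrite subn0 subnn fact0 divr1 rodrigues_diag /weighted_int -mulrA -natrM.
  rewrite mulr_natr -scaler_nat pintZ pint_weight addnn -mul2n addn1 factS !natrM.
  have f0 : (2 * l)`!%:R != 0 :> R by rewrite pnatr_eq0 -lt0n fact_gt0.
  have n1 : (2 * l).+1%:R != 0 :> R by rewrite pnatr_eq0.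
  rewrite exprS [X in 2 ^+ X]mulnC exprM; move: f0 n1; set F := (_`!)%:R => f0 n1; field.
  by rewrite f0 andbT; have := n1; rewrite -natr1 natrM addrC mulrC.
set m := (l - k.+1)%N.
have lk : (l - k)%N = m.+1 by rewrite /m; lia.
have lmk : l = (m + k.+1)%N by rewrite /m; lia.
have := gegenbauer_by_parts m (rodrigues l m) (rodrigues l m).
rewrite gegenbauer_rodrigues ?leq_subr// weighted_intZl -rodrigues_recr -lk IH ?(ltnW kl)//.
rewrite subKn ?(ltnW kl)// subKn// lk addnS.
set w := weighted_int _ _ _; set X := (_ ^+ 2); set Y := (2 / _) => E.
have f2 : k`!%:R != 0 :> R by rewrite pnatr_eq0 -lt0n fact_gt0.
have n1 : (l + m).+1%:R != 0 :> R by rewrite pnatr_eq0.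
have n2 : k.+1%:R != 0 :> R by rewrite pnatr_eq0.
(* Since k + 1 = l - m, this nonzero factor is l(l+1) - m(m+1), the total coefficient of [w] in
   E. *)
apply: (mulfI (mulf_neq0 n1 n2)).
have -> : (l + m).+1%:R * k.+1%:R = (l * l.+1)%:R - (m * m.+1)%:R :> R.
  by rewrite {1 2 3}lmk !natrM -!natr1 !natrD -!natr1; ring.
have -> : ((l * l.+1)%:R - (m * m.+1)%:R) * w =
  (l + m).+1`!%:R / k`!%:R * X * Y by lra.
have -> : (l * l.+1)%:R - (m * m.+1)%:R = (l + m).+1%:R * k.+1%:R :> R.
  by rewrite {1 2}lmk [in RHS]lmk !natrM -!natr1 !natrD -!natr1; ring.
rewrite !factS !natrM; field; exact/andP.
Qed.

End rodrigues.

(** * Differential operators on the chart *)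

Section complex_derivative.
Variable R : realType.
Implicit Types (h k : R -> R[i]) (x : R) (d : R[i]).

Definition is_cderive h x d :=
  is_derive x 1 (fun t => complex.Re (h t)) (complex.Re d) /\
  is_derive x 1 (fun t => complex.Im (h t)) (complex.Im d).

Lemma is_cderiveE h x d : is_cderive h x d -> cderive1 h x = d.
Proof.
case=> [[_ r] [_ i]]; rewrite /cderive1 !derive1E r i.
by case: d {r i}.
Qed.

Lemma is_cderive_derivable h x d : is_cderive h x d -> cderivable h x.
Proof. by case=> [[r _] [i _]]. Qed.

Lemma cderivableP h x : cderivable h x -> is_cderive h x (cderive1 h x).
Proof. by case=> r i; split; rewrite /cderive1 !derive1E; exact: derivableP. Qed.

Lemma near_is_cderive h k x d :
  (\forall t \near x, h t = k t) -> is_cderive h x d -> is_cderive k x d.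
Proof.
move=> hk [r i]; split.
  by apply: near_eq_is_derive r; near=> t; rewrite (near hk t).
by apply: near_eq_is_derive i; near=> t; rewrite (near hk t).
Unshelve. all: by end_near. Qed.

Lemma near_cderive1 h k x :
  (\forall t \near x, h t = k t) -> cderive1 h x = cderive1 k x.
Proof.
move=> hk; rewrite /cderive1 !derive1E; congr (_ +i* _).
  by apply: near_eq_derive; near=> t; rewrite (near hk t).
by apply: near_eq_derive; near=> t; rewrite (near hk t).
Unshelve. all: by end_near. Qed.

Lemma Re_addc (z w : R[i]) : complex.Re (z + w) = complex.Re z + complex.Re w.
Proof. by case: z w => [a b] [c d]. Qed.

Lemma Im_addc (z w : R[i]) : complex.Im (z + w) = complex.Im z + complex.Im w.
Proof. by case: z w => [a b] [c d]. Qed.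

(** The difference quotients coincide before any limit is taken, so this is an identity at every
    point, and additive constants disappear from the differential operators without side
    conditions. *)
Lemma cderive1_addcl c h x : cderive1 (fun t => c + h t) x = cderive1 h x.
Proof.
have E (e : R) (u : R -> R) : derive1 (fun t => e + u t) x = derive1 u x.
  rewrite /derive1 (_ : (fun s => s^-1 *: (e + u (s + x) - (e + u x))) =
    (fun s => s^-1 *: (u (s + x) - u x)))//.
  by apply/funext => s; rewrite opprD addrACA subrr add0r.
rewrite /cderive1 -(E (complex.Re c) (fun t => complex.Re (h t))).
rewrite -(E (complex.Im c) (fun t => complex.Im (h t))).
by congr (_ +i* _); congr (derive1 _ x); apply/funext => t; rewrite (Re_addc, Im_addc).
Qed.

Lemma Re_mulc (z w : R[i]) : complex.Re (z * w) =
  complex.Re z * complex.Re w - complex.Im z * complex.Im w.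
Proof. by case: z w => [a b] [c d]. Qed.

Lemma Im_mulc (z w : R[i]) : complex.Im (z * w) =
  complex.Re z * complex.Im w + complex.Im z * complex.Re w.
Proof. by case: z w => [a b] [c d]. Qed.

Lemma is_cderive_cis (c : R[i]) (k x : R) :
  is_cderive (fun t => c * cis (k * t)) x (c * ('i%C * k%:C) * cis (k * x)).
Proof.
have dc : is_derive x 1 (fun t => cos (k * t)) (- sin (k * x) * k).
  apply: (@is_derive1_comp _ cos ( *%R k)); rewrite -[X in is_derive _ _ _ X]mulr1.
  exact: is_deriveZ.
have ds : is_derive x 1 (fun t => sin (k * t)) (cos (k * x) * k).
  apply: (@is_derive1_comp _ sin ( *%R k)); rewrite -[X in is_derive _ _ _ X]mulr1.
  exact: is_deriveZ.
split.
  under eq_fun do rewrite Re_mulc.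
  apply: is_derive_eq (is_deriveB (is_deriveZ (complex.Re c) dc) (is_deriveZ (complex.Im c) ds)) _.
  by rewrite !(Re_mulc, Im_mulc) /GRing.scale /=; ring.
under eq_fun do rewrite Im_mulc.
apply: is_derive_eq (is_deriveD (is_deriveZ (complex.Re c) ds) (is_deriveZ (complex.Im c) dc)) _.
by rewrite !(Re_mulc, Im_mulc) /GRing.scale /=; ring.
Qed.

Lemma is_cderive_real (c : R[i]) (u : R -> R) x (d : R) :
  is_derive x 1 u d -> is_cderive (fun t => (u t)%:C * c) x (d%:C * c).
Proof.
move=> du; split.
  under eq_fun do rewrite Re_mulc /= mul0r subr0 mulrC.
  rewrite Re_mulc /= mul0r subr0 mulrC; exact: is_deriveZ.
under eq_fun do rewrite Im_mulc /= mul0r addr0 mulrC.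
rewrite Im_mulc /= mul0r addr0 mulrC; exact: is_deriveZ.
Qed.

Lemma derive0_itv_cst (a b : R) (u : R -> R) :
  (forall x, x \in `]a, b[ -> is_derive x 1 u 0) ->
  forall x y, x \in `]a, b[ -> y \in `]a, b[ -> u x = u y.
Proof.
move=> du x y; wlog xy : x y / x <= y.
  by move=> H xi yi; case: (leP x y) => [/H|/ltW /H ->//]; exact.
move=> xi yi.
have sub : {subset `[x, y] <= `]a, b[}.
  move: xi yi; rewrite !in_itv /= => /andP[ax xb] /andP[ay yb] z.
  by rewrite !in_itv /= => /andP[xz zy]; rewrite (lt_le_trans ax)// (le_lt_trans zy).
have du' z : z \in `]x, y[ -> is_derive z 1 u (cst 0 z).
  by move=> /subset_itv_oo_cc /sub /du.
have cu : {within `[x, y], continuous u}.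
  by apply: derivable_within_continuous => z /sub /du[].
have [c _ /eqP] := MVT_segment xy du' cu.
by rewrite mul0r subr_eq0 => /eqP.
Qed.

Lemma cderive_eq_cst (a b : R) h k :
  (forall x, x \in `]a, b[ ->
    [/\ cderivable h x, cderivable k x & cderive1 h x = cderive1 k x]) ->
  forall x y, x \in `]a, b[ -> y \in `]a, b[ -> h x - k x = h y - k y.
Proof.
move=> hk x y xab yab.
have Re0 z : z \in `]a, b[ ->
    is_derive z 1 (fun t => complex.Re (h t) - complex.Re (k t)) 0.
  move=> /hk[/cderivableP[dh _] /cderivableP[dk _] E].
  by apply: is_derive_eq (is_deriveB dh dk) _; rewrite E subrr.
have Im0 z : z \in `]a, b[ ->
    is_derive z 1 (fun t => complex.Im (h t) - complex.Im (k t)) 0.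
  move=> /hk[/cderivableP[_ dh] /cderivableP[_ dk] E].
  by apply: is_derive_eq (is_deriveB dh dk) _; rewrite E subrr.
have := derive0_itv_cst Re0 xab yab; have := derive0_itv_cst Im0 xab yab.
case: (h x) (k x) (h y) (k y) => [a1 b1] [a2 b2] [a3 b3] [a4 b4] /= E1 E2.
by apply/eqP; rewrite eq_complex /= E1 E2 !eqxx.
Qed.

End complex_derivative.

(** * Functions F(mu) e^(i m lambda) and the operators acting on them *)

Section zonal.
Variable R : realType.
Implicit Types (f g : R * R -> R[i]) (F : R -> R) (p : R * R) (c : R[i]).
Implicit Types (m : int) (M : nat) (q : {poly R}) (x : R).

(** The congruence under which all computations are done: the chart is open, so derivatives respect
    it, and integrals only see the chart. *)
Definition eq_chart f g := forall p, chart p -> f p = g p.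

Lemma chartP p : chart p = ((p.1 \in `]0, 2 * pi[) /\ (p.2 \in `](-1), 1[)) :> Prop.
Proof. by []. Qed.

Lemma near_chart1 p : chart p -> \forall t \near p.1, chart (t, p.2).
Proof.
rewrite chartP => -[p1 p2]; near=> t; rewrite chartP; split => //=.
near: t; exact: near_in_itvoo.
Unshelve. all: by end_near. Qed.

Lemma near_chart2 p : chart p -> \forall t \near p.2, chart (p.1, t).
Proof.
rewrite chartP => -[p1 p2]; near=> t; rewrite chartP; split => //=.
near: t; exact: near_in_itvoo.
Unshelve. all: by end_near. Qed.

Lemma dlambda_eq_chart f g :
  eq_chart f g -> eq_chart (dlambda f) (dlambda g).
Proof.
move=> fg p hp; apply: near_cderive1; near=> t.
by apply: fg; near: t; exact: near_chart1.
Unshelve. all: by end_near. Qed.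

Lemma dmu_eq_chart f g : eq_chart f g -> eq_chart (dmu f) (dmu g).
Proof.
move=> fg p hp; apply: near_cderive1; near=> t.
by apply: fg; near: t; exact: near_chart2.
Unshelve. all: by end_near. Qed.

Lemma poisson_eq_chart f f' g g' : eq_chart f f' -> eq_chart g g' ->
  eq_chart (poisson f g) (poisson f' g').
Proof.
move=> ff gg p hp; rewrite /poisson.
by rewrite (dlambda_eq_chart ff) ?(dlambda_eq_chart gg) ?(dmu_eq_chart ff) ?(dmu_eq_chart gg).
Qed.

Lemma laplacian_eq_chart f g :
  eq_chart f g -> eq_chart (laplacian f) (laplacian g).
Proof.
move=> fg p hp; rewrite /laplacian.
rewrite (dlambda_eq_chart (dlambda_eq_chart fg) hp).
have E : eq_chart (fun r => (1 - r.2 ^+ 2)%:C * dmu f r)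
                  (fun r => (1 - r.2 ^+ 2)%:C * dmu g r).
  by move=> r hr; rewrite (dmu_eq_chart fg hr).
by rewrite (dmu_eq_chart E hp).
Qed.

Lemma dlambda_addcl c f : dlambda (fun p => c + f p) = dlambda f.
Proof. by apply/funext => p; exact: cderive1_addcl. Qed.

Lemma dmu_addcl c f : dmu (fun p => c + f p) = dmu f.
Proof. by apply/funext => p; exact: cderive1_addcl. Qed.

Lemma poisson_addcl c c' f g :
  poisson (fun p => c + f p) (fun p => c' + g p) = poisson f g.
Proof. by apply/funext => p; rewrite /poisson !dlambda_addcl !dmu_addcl. Qed.

Lemma laplacian_addcl c f : laplacian (fun p => c + f p) = laplacian f.
Proof. by apply/funext => p; rewrite /laplacian dlambda_addcl dmu_addcl. Qed.

(** The chart is a rectangle: from any point go vertically to the equator, then along it to (pi, 0).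
    Each segment involves a single partial derivative, so one-variable constancy suffices. *)
Lemma eq_chart_up_to_cst f g :
  (forall p, chart p ->
    [/\ cderivable (fun t => f (t, p.2)) p.1, cderivable (fun t => f (p.1, t)) p.2,
        cderivable (fun t => g (t, p.2)) p.1 & cderivable (fun t => g (p.1, t)) p.2]) ->
  eq_chart (dlambda f) (dlambda g) -> eq_chart (dmu f) (dmu g) ->
  exists c, eq_chart f (fun p => c + g p).
Proof.
move=> d fg1 fg2.
have pi0 : (pi : R) \in `]0, 2 * pi[.
  by rewrite in_itv /=; have := pi_gt0 R => ?; apply/andP; split; lra.
have o0 : (0 : R) \in `](-1), 1[ by rewrite in_itv /=; apply/andP; split; lra.
exists (f (pi, 0) - g (pi, 0)) => -[x y] [/= px py].
have E1 : f (x, y) - g (x, y) = f (x, 0) - g (x, 0).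
  apply: (@cderive_eq_cst _ (-1) 1 (fun t => f (x, t)) (fun t => g (x, t))) => // t ht.
  have hp : chart (x, t) by [].
  have [_ d2 _ d4] := d _ hp.
  by split=> //; exact: (fg2 _ hp).
have E2 : f (x, 0) - g (x, 0) = f (pi, 0) - g (pi, 0).
  apply: (@cderive_eq_cst _ 0 (2 * pi) (fun t => f (t, 0)) (fun t => g (t, 0))) => // t ht.
  have hp : chart (t, 0) by [].
  have [d1 _ d3 _] := d _ hp.
  by split=> //; exact: (fg1 _ hp).
by rewrite -E2 -E1 subrK.
Qed.

Definition zonal c m F p := c * (F p.2)%:C * cis (m%:~R * p.1).

Lemma is_cderive_zonal1 c m F p :
  is_cderive (fun t => zonal c m F (t, p.2)) p.1 (zonal (c * ('i%C * m%:~R%:C)) m F p).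
Proof.
rewrite /zonal [c * ('i%C * _) * _]mulrAC.
exact: (is_cderive_cis (c * (F p.2)%:C) m%:~R p.1).
Qed.

Lemma is_cderive_zonal2 c m F F' p : is_derive p.2 1 F (F' p.2) ->
  is_cderive (fun t => zonal c m F (p.1, t)) p.2 (zonal c m F' p).
Proof.
move=> dF; rewrite /zonal [c * _]mulrC -mulrA.
have := is_cderive_real (c * cis (m%:~R * p.1)) dF.
by apply: near_is_cderive; near=> t; rewrite mulrA [c * _]mulrC.
Unshelve. all: by end_near. Qed.

Lemma dlambda_zonal c m F :
  dlambda (zonal c m F) = zonal (c * ('i%C * m%:~R%:C)) m F.
Proof. by apply/funext => p; apply: is_cderiveE (is_cderive_zonal1 _ _ _ _). Qed.

Lemma dmu_zonal c m F F' :
  (forall x, x \in `](-1), 1[ -> is_derive x 1 F (F' x)) ->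
  eq_chart (dmu (zonal c m F)) (zonal c m F').
Proof.
move=> dF p hp; apply: is_cderiveE; apply: is_cderive_zonal2.
by apply: dF; move: hp; rewrite chartP => -[].
Qed.

Lemma cisD (x y : R) : cis (x + y) = cis x * cis y.
Proof.
by apply/eqP; rewrite eq_complex /= cosD sinD eqxx /=; apply/eqP; ring.
Qed.

Lemma poisson_zonal c1 c2 m1 m2 F1 F2 F1' F2' :
  (forall x, x \in `](-1), 1[ -> is_derive x 1 F1 (F1' x)) ->
  (forall x, x \in `](-1), 1[ -> is_derive x 1 F2 (F2' x)) ->
  eq_chart (poisson (zonal c1 m1 F1) (zonal c2 m2 F2))
    (zonal (c1 * c2 * 'i%C) (m1 + m2)
      (fun x => m1%:~R * (F1 x * F2' x) - m2%:~R * (F1' x * F2 x))).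
Proof.
move=> d1 d2 p hp.
rewrite /poisson !dlambda_zonal (dmu_zonal _ _ d1)// (dmu_zonal _ _ d2)//.
rewrite /zonal intrD mulrDl cisD !(rmorphB, rmorphM) /=; ring.
Qed.

Definition radial M q (x : R) := Num.sqrt (1 - x ^+ 2) ^+ M * q.[x].

(** The derivative of (1 - x^2)^(M/2) q is (1 - x^2)^(M/2) times this polynomial, divided by 1 -
    x^2. Leaving the denominator outside avoids the exponent M/2 - 1, which is negative for M <
    2. *)
Definition radial_deriv M q : {poly R} :=
  (1 - 'X^2) * q^`() - M%:R * 'X * q.

Lemma in_itv_weight (x : R) : x \in `](-1), 1[ -> 0 < 1 - x ^+ 2.
Proof. by rewrite in_itv /=; nra. Qed.

Lemma is_derive_radial M q (x : R) : x \in `](-1), 1[ ->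
  is_derive x 1 (radial M q) (radial M (radial_deriv M q) x / (1 - x ^+ 2)).
Proof.
move=> /in_itv_weight w0.
set s := Num.sqrt (1 - x ^+ 2).
have s0 : s != 0 by rewrite gt_eqF ?sqrtr_gt0.
have s2 : s ^+ 2 = 1 - x ^+ 2 by rewrite sqr_sqrtr ?ltW.
have dw : is_derive x 1 (fun t : R => 1 - t ^+ 2) (- (2 * x)).
  have -> : (fun t : R => 1 - t ^+ 2) = horner (1 - 'X^2).
    by apply/funext => t; rewrite !hornerE.
  apply: is_derive_eq (is_derive_poly _ _) _.
  by rewrite derivB derivXn derivC sub0r expr1 !hornerE mulr_natl.
have ds : is_derive x 1 (fun t : R => Num.sqrt (1 - t ^+ 2)) (- x / s).
  have H := @is_derive1_comp R Num.sqrt (fun t => 1 - t ^+ 2) x _ _ (is_derive1_sqrt w0) dw.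
  apply: (is_derive_eq H); rewrite -/s; field.
  by rewrite s0.
have dsM : is_derive x 1 (fun t : R => Num.sqrt (1 - t ^+ 2) ^+ M) (- M%:R * x * s ^+ M / s ^+ 2).
  have := is_deriveX M ds; rewrite exprfctE => dX; apply: is_derive_eq dX _.
  rewrite -/s /GRing.scale /=; case: M => [|M] /=.
    by rewrite oppr0 !mul0r.
  by rewrite exprS; field.
apply: is_derive_eq (is_deriveM dsM (is_derive_poly q x)) _.
rewrite /radial /radial_deriv -/s -polyC_natr !hornerE -s2 /GRing.scale /=.
by rewrite s2; field; rewrite -s2 expf_neq0.
Qed.

(** Here the singularity of the Laplacian cancels: up to (1 - mu^2)^(M/2), the left side is the
    Laplacian multiplied by 1 - mu^2, and it is divisible by 1 - X^2. *)
Lemma radial_derivK M q :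
  radial_deriv M (radial_deriv M q) - (M ^ 2)%:R * q = (1 - 'X^2) * gegenbauer_op M q.
Proof.
rewrite /gegenbauer_op /radial_deriv !(derivD, derivN, derivM, derivXn, derivX, deriv_natr, derivC).
rewrite natrM -natr1 -mulr_natl natrX expr1; ring.
Qed.

Lemma natr_sqr_absz m : (`|m| ^ 2)%:R = m%:~R ^+ 2 :> R.
Proof. by rewrite natrX natr_absz intr_norm real_normK ?num_real. Qed.

Lemma laplacian_zonal c m q :
  eq_chart (laplacian (zonal c m (radial `|m| q)))
           (zonal c m (radial `|m| (gegenbauer_op `|m| q))).
Proof.
move=> p hp; rewrite /laplacian !dlambda_zonal.
have w0 : p.2 \in `](-1), 1[ -> 1 - p.2 ^+ 2 != 0.
  by move=> /in_itv_weight w0; rewrite gt_eqF.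
have {}w0 : 1 - p.2 ^+ 2 != 0 by apply: w0; case: hp.
set M := `|m|%N; set D := radial_deriv M.
have dm q' := dmu_zonal c m (@is_derive_radial M q').
have E : eq_chart (fun r => (1 - r.2 ^+ 2)%:C * dmu (zonal c m (radial M q)) r)
                  (zonal c m (radial M (D q))).
  move=> r hr; rewrite dm// /zonal -/D.
  have r0 : 1 - r.2 ^+ 2 != 0 by case: hr => _ /in_itv_weight r0; rewrite gt_eqF.
  have : (1 - r.2 ^+ 2)%:C != 0 by rewrite (inj_eq (@complexI R) _ 0).
  rewrite rmorphM fmorphV /=; move: (1 - r.2 ^+ 2)%:C => W W0.
  by field.
rewrite (dmu_eq_chart E hp) dm// /zonal.
have -> : c * ('i%C * m%:~R%:C) * ('i%C * m%:~R%:C) = c * (- (m%:~R ^+ 2))%:C.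
  rewrite -mulrA mulrACA -expr2 sqr_i mulN1r -rmorphM /= -expr2.
  by rewrite rmorphN.
have -> : radial M (gegenbauer_op M q) p.2 =
    radial M (D (D q)) p.2 / (1 - p.2 ^+ 2) - m%:~R ^+ 2 * radial M q p.2 / (1 - p.2 ^+ 2).
  have := congr1 (fun q => q.[p.2]) (radial_derivK M q).
  rewrite -/D; move: (gegenbauer_op M q) (D (D q)) => A B.
  rewrite -polyC_natr natr_sqr_absz !hornerE /radial => /(canRL (subrK _)) -> /=.
  by field.
rewrite -/D; move: (radial M (D (D q)) p.2) (radial M q p.2) (1 - p.2 ^+ 2) (m%:~R ^+ 2) (cis _).
by move=> a b w k e; rewrite !(rmorphB, rmorphM, rmorphN) /= !fmorphV; ring.
Qed.

End zonal.

(** * Spherical harmonics *)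

Section spherical_harmonics.
Variable R : realType.
Implicit Types (f g : R * R -> R[i]) (F : R -> R) (p : R * R) (c : R[i]).
Implicit Types (m : int) (l M : nat) (q : {poly R}) (x : R).

Lemma horner_weight x : (1 - 'X^2 : {poly R}).[x] = 1 - x ^+ 2.
Proof. by rewrite !hornerE. Qed.

Lemma radial_mulX2B1 M k q x : x \in `](-1), 1[ ->
  radial (M + 2 * k) q x = radial M ((1 - 'X^2) ^+ k * q) x.
Proof.
move=> /in_itv_weight w0.
by rewrite /radial exprD exprM sqr_sqrtr ?ltW// hornerM horner_exp horner_weight mulrA.
Qed.

(* If m1 and m2 have the same sign, the terms in X q1 q2 of the bracket cancel
   and |m1 + m2| = |m1| + |m2|; otherwise |m1| + |m2| - |m1 + m2| is even and
   positive, which absorbs the denominator 1 - x^2. *)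
Lemma bracket_radial m1 m2 q1 q2 : exists q, forall x, x \in `](-1), 1[ ->
  m1%:~R * (radial `|m1| q1 x * (radial `|m2| (radial_deriv `|m2| q2) x / (1 - x ^+ 2)))
  - m2%:~R * ((radial `|m1| (radial_deriv `|m1| q1) x / (1 - x ^+ 2)) * radial `|m2| q2 x)
  = radial (absz (m1 + m2)) q x.
Proof.
have [k hk] : exists k, (`|m1| + `|m2| = absz (m1 + m2)%R + 2 * k)%N.
  by exists ((`|m1| + `|m2| - absz (m1 + m2)%R) %/ 2)%N; lia.
pose A : {poly R} := m1%:~R *: (q1 * q2^`()) - m2%:~R *: (q1^`() * q2).
(* B collects what the terms - M X q of the two [radial_deriv] contribute; only this part lacks a
   factor 1 - X^2. *)
pose B : {poly R} := (m2%:~R * `|m1|%:R - m1%:~R * `|m2|%:R) *: ('X * q1 * q2).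
have E x : x \in `](-1), 1[ ->
  m1%:~R * (radial `|m1| q1 x * (radial `|m2| (radial_deriv `|m2| q2) x / (1 - x ^+ 2)))
  - m2%:~R * ((radial `|m1| (radial_deriv `|m1| q1) x / (1 - x ^+ 2)) * radial `|m2| q2 x)
  = radial (absz (m1 + m2)%R + 2 * k) ((1 - 'X^2) * A + B) x / (1 - x ^+ 2).
  move=> /in_itv_weight w0; rewrite -hk /radial exprD /radial_deriv /A /B -!polyC_natr.
  by rewrite !hornerE /=; field; rewrite gt_eqF.
case: k => [|k] in hk E *.
  exists A => x hx; rewrite E// muln0 addn0 /radial /B.
  have -> : m2%:~R * `|m1|%:R - m1%:~R * `|m2|%:R = 0 :> R.
    rewrite !natr_absz -!intrM -intrB (_ : m2 * `|m1|%N - m1 * `|m2|%N = 0)//.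
    by rewrite !abszE; nia.
  move: hx => /in_itv_weight w0; clear E; move: A => A.
  by rewrite scale0r addr0 !hornerE /=; field; rewrite gt_eqF.
exists ((1 - 'X^2) ^+ k * ((1 - 'X^2) * A + B)) => x hx; rewrite E// radial_mulX2B1//.
move: hx => /in_itv_weight w0; rewrite /radial; clear E; move: A B => A B.
by rewrite [_ ^+ k.+1]exprS -!mulrA !hornerM horner_weight; field; rewrite gt_eqF.
Qed.

(** The polynomial is chosen before the constants, so that {Y1, Y2}, {f, g} and {Delta f, g} all
    share the same [q]. *)
Lemma poisson_zonal_radial m1 m2 q1 q2 : exists q, forall c1 c2,
  eq_chart (poisson (zonal c1 m1 (radial `|m1| q1)) (zonal c2 m2 (radial `|m2| q2)))
           (zonal (c1 * c2 * 'i%C) (m1 + m2) (radial (absz (m1 + m2)) q)).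
Proof.
have [q hq] := bracket_radial m1 m2 q1 q2; exists q => c1 c2 p hp.
rewrite (poisson_zonal _ _ _ _ (@is_derive_radial _ _ _) (@is_derive_radial _ _ _) hp).
by rewrite /zonal hq//; case: hp.
Qed.

Lemma derive1n_horner n q : derive1n n (horner q) = horner q^`(n).
Proof. by elim: n => [//|n IH]; rewrite derive1nS IH -derivE -derivnS. Qed.

Lemma assoc_legendre_radial l M x : x \in `](-1), 1[ ->
  assoc_legendre l M x = radial M (rodrigues R l M) x / (2 ^+ l * l`!%:R).
Proof.
move=> /in_itv_weight w0; rewrite /assoc_legendre /radial.
have -> : (fun y : R => (y ^+ 2 - 1) ^+ l) = horner (('X^2 - 1) ^+ l).
  by apply/funext => y; rewrite horner_exp !hornerE.
rewrite derive1n_horner -/(rodrigues R l M) [M%:R / 2]mulrC powRrM powR12_sqrt ?ltW//.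
by rewrite powR_mulrn ?sqrtr_ge0// mulrAC.
Qed.

Lemma radialZ M (a : R) q x : radial M (a *: q) x = a * radial M q x.
Proof. by rewrite /radial hornerZ mulrCA. Qed.

(** The sign appears only for m >= 0: for negative m, the factor (-1)^m relating Y_(l,-m) to the
    conjugate of Y_(lm) cancels the one inside Y_(lm). The last divisor restores the constant
    dropped from [rodrigues]. *)
Definition sph_norm l m : R :=
  (if m is Posz n then (- 1) ^+ n else 1)
  * Num.sqrt ((2 * l + 1)%:R / (4 * pi) * ((l - `|m|)`!%:R / (l + `|m|)`!%:R))
  / (2 ^+ l * l`!%:R).

Definition sph_poly l m : {poly R} := sph_norm l m *: rodrigues R l `|m|.

Lemma sph_harm_nat_zonal l M p : chart p ->
  sph_harm_nat l M p = zonal 1 M (radial M (sph_poly l M)) p.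
Proof.
move=> [_ p2]; rewrite /sph_harm_nat assoc_legendre_radial// /zonal mul1r.
congr (_%:C * _); rewrite /radial /sph_poly hornerZ /sph_norm absz_nat; ring.
Qed.

Lemma conjcM (z w : R[i]) : conjc (z * w) = conjc z * conjc w.
Proof. exact: (rmorphM (@conjc R)). Qed.

Lemma conj_cis x : conjc (cis x) = cis (- x).
Proof. by rewrite /cis /= cosN sinN. Qed.

Lemma sph_harm_zonal l m :
  eq_chart (@sph_harm R l m) (zonal 1 m (radial `|m| (sph_poly l m))).
Proof.
move=> p hp; case: m => [n|n]; rewrite /sph_harm sph_harm_nat_zonal//.
rewrite /zonal !mul1r conjcM conjc_real conj_cis -mulNr NegzE intrN.
rewrite /sph_poly ?(abszN, absz_nat) !radialZ.
have -> : sph_norm l n.+1 = (- 1) ^+ n.+1 * sph_norm l (- n.+1%:Z).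
  by rewrite /sph_norm -NegzE /= mul1r !mulrA.
move: (sph_norm l _) (radial _ _ _) => a b.
by rewrite mulrA -[_ * a * b]mulrA rmorphM rmorphXn rmorphN1 mulrA -expr2 sqrr_sign mul1r.
Qed.

Lemma sph_harm_cderivable l m p : chart p ->
  cderivable (fun t => @sph_harm R l m (t, p.2)) p.1 /\
  cderivable (fun t => @sph_harm R l m (p.1, t)) p.2.
Proof.
move=> hp; split.
  apply: is_cderive_derivable; apply: (near_is_cderive _ (is_cderive_zonal1 _ _ _ _)).
  near=> t; apply/esym/sph_harm_zonal; near: t; exact: near_chart1.
have p2 : p.2 \in `](-1), 1[ by case: hp.
have dr := is_derive_radial `|m| (sph_poly l m) p2.
apply: is_cderive_derivable.
(* Only the value of the derivative at p.2 enters, so a constant function can stand for F'. *)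
apply: (near_is_cderive _ (is_cderive_zonal2 1 m (F' := cst _) dr)).
near=> t; apply/esym/sph_harm_zonal; near: t; exact: near_chart2.
Unshelve. all: by end_near. Qed.

(** The harmonic is itself a stream function, so the choice does not fall back on its default 0;
    whatever is chosen has the same partial derivatives as the harmonic on the chart. *)
Lemma stream_function_sph_field l m : exists c,
  eq_chart (stream_function (@sph_field R l m))
           (fun p => c + zonal 1 m (radial `|m| (sph_poly l m)) p).
Proof.
have : is_stream_function (@sph_field R l m) (stream_function (@sph_field R l m)).
  apply: (@xgetPex _ (fun=> 0) [set f | is_stream_function (@sph_field R l m) f]).
  exists (@sph_harm R l m) => p hp; have [d1 d2] := sph_harm_cderivable l m hp.
  by split.
set f := stream_function _ => hf.
have [|p hp|p hp|c hc] := @eq_chart_up_to_cst R f (@sph_harm R l m).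
- move=> p hp; have [d1 d2 _] := hf p hp; have [d3 d4] := sph_harm_cderivable l m hp.
  by split.
- by have [_ _ E] := hf p hp; exact: (congr1 snd E).
- by have [_ _ E] := hf p hp; apply: oppr_inj; exact: (congr1 fst E).
by exists c => p hp; rewrite hc// sph_harm_zonal.
Qed.

End spherical_harmonics.

(** * Integration over the sphere *)

Section product_integral.
Context d1 d2 (T1 : measurableType d1) (T2 : measurableType d2) (R : realType).
Variables (m1 : {sigma_finite_measure set T1 -> \bar R}).
Variables (m2 : {sigma_finite_measure set T2 -> \bar R}).

Let prod_fun (u : T1 -> R) (v : T2 -> R) (p : T1 * T2) : \bar R :=
  (u p.1 * v p.2)%:E.

(** By Tonelli, the iterated integral of the absolute value factors into two finite integrals. *)
Let integrable_prodT (u : T1 -> R) (v : T2 -> R) :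
  m1.-integrable setT (EFin \o u) -> m2.-integrable setT (EFin \o v) ->
  (m1 \x m2)%E.-integrable setT (prod_fun u v).
Proof.
move=> iu iv.
have mu : measurable_fun setT u by apply/measurable_EFinP; exact: measurable_int iu.
have mv : measurable_fun setT v by apply/measurable_EFinP; exact: measurable_int iv.
have mf : measurable_fun setT (prod_fun u v).
  apply/measurable_EFinP; apply: measurable_funM.
    exact: (@measurableT_comp _ _ _ _ _ _ u _ fst).
  exact: (@measurableT_comp _ _ _ _ _ _ v _ snd).
apply/integrable12ltyP => //.
have -> : (fun x => \int[m2]_y `|prod_fun u v (x, y)|)%E =
          (fun x => (\int[m2]_y `|(v y)%:E|) * `|(u x)%:E|)%E.
  apply/funext => x; under eq_integral => y _ do rewrite /prod_fun /= normrM EFinM.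
  rewrite ge0_integralZl ?lee_fin// 1?muleC//.
  by do 2 apply: measurableT_comp => //.
have [_ +] := integrableP _ _ _ iu; have [_ +] := integrableP _ _ _ iv.
rewrite /= => fv fu.
rewrite ge0_integralZl//; last 2 first.
- by do 2 apply: measurableT_comp => //.
- exact: integral_ge0.
- by rewrite lte_mul_pinfty ?integral_ge0// fin_num_abs gee0_abs ?integral_ge0.
Qed.

Let Rintegral_prodT (u : T1 -> R) (v : T2 -> R) :
  m1.-integrable setT (EFin \o u) -> m2.-integrable setT (EFin \o v) ->
  (\int[m1 \x m2]_p (prod_fun u v p) =
   (\int[m1]_x (u x)%:E) * (\int[m2]_y (v y)%:E))%E.
Proof.
move=> iu iv; rewrite -integral12_prod_meas1; last exact: integrable_prodT.
have fv := integrable_fin_num measurableT iv.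
rewrite -(fineK fv) -integralZr//.
apply: eq_integral => x _; rewrite /= fineK//.
by rewrite -integralZl//; apply: eq_integral.
Qed.

Variables (A : set T1) (B : set T2) (u : T1 -> R) (v : T2 -> R).
Hypotheses (mA : measurable A) (mB : measurable B).
Hypotheses (iu : m1.-integrable A (EFin \o u)) (iv : m2.-integrable B (EFin \o v)).

(** Extension by zero from a rectangle respects products, which reduces the case of [A] and [B] to
    the whole spaces. *)
Let patchE : (EFin \o (fun p => u p.1 * v p.2)) \_ (A `*` B) = prod_fun (u \_ A) (v \_ B).
Proof.
apply/funext => -[x y]; rewrite /prod_fun /patch /= in_setX.
by case: (x \in A); case: (y \in B); rewrite /= ?(mul0r, mulr0).
Qed.

Let iuT : m1.-integrable setT (EFin \o (u \_ A)).
Proof. by rewrite -restrict_EFin; apply: (integrable_mkcond _ mA).1 iu. Qed.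

Let ivT : m2.-integrable setT (EFin \o (v \_ B)).
Proof. by rewrite -restrict_EFin; apply: (integrable_mkcond _ mB).1 iv. Qed.

Lemma integrable_setX_prod :
  (m1 \x m2)%E.-integrable (A `*` B) (EFin \o (fun p => u p.1 * v p.2)).
Proof.
apply/integrable_mkcond; first exact: measurableX.
by rewrite patchE; exact: integrable_prodT.
Qed.

Lemma Rintegral_setX_prod :
  Rintegral (m1 \x m2)%E (A `*` B) (fun p => u p.1 * v p.2) =
  Rintegral m1 A u * Rintegral m2 B v.
Proof.
rewrite [in RHS]Rintegral_mkcond [X in _ * X]Rintegral_mkcond /Rintegral.
rewrite integral_mkcond patchE Rintegral_prodT// fineM//; exact: integrable_fin_num.
Qed.

End product_integral.

(** * Linearity of the sphere integral and its value on F(mu) e^(i k lambda) *)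

Section sphere_integral.
Variable R : realType.
Implicit Types (f g : R * R -> R[i]) (F : R -> R) (p : R * R) (c : R[i]).
Implicit Types (m k : int) (l M : nat) (q : {poly R}) (x : R).

(** Lebesgue measure with its sigma-finite structure made explicit, as the product lemmas expect;
    [sphere_integralE] checks by conversion that the integral is unchanged. *)
Let leb : {sigma_finite_measure set (measurableTypeR R) -> \bar R} := @lebesgue_measure R.
Let area := (leb \x leb)%E.

Definition sphere_integrable f :=
  area.-integrable (@chart R) (EFin \o (fun p => complex.Re (f p))) /\
  area.-integrable (@chart R) (EFin \o (fun p => complex.Im (f p))).

Lemma measurable_chart : measurable (@chart R : set (measurableTypeR R * measurableTypeR R)).
Proof. by apply: measurableX. Qed.

Let sphere_integralE f : sphere_integral f =
  Rintegral area (@chart R) (fun p => complex.Re (f p))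
  +i* Rintegral area (@chart R) (fun p => complex.Im (f p)).
Proof. by []. Qed.

Lemma eq_sphere_integral f g : eq_chart f g -> sphere_integral f = sphere_integral g.
Proof.
move=> fg; rewrite !sphere_integralE; congr (_ +i* _);
  by apply: eq_Rintegral => p; rewrite inE => hp; rewrite fg.
Qed.

Lemma eq_sphere_integrable f g :
  eq_chart f g -> sphere_integrable f -> sphere_integrable g.
Proof.
move=> fg [fr fi]; split.
  apply: eq_integrable fr; first exact: measurable_chart.
  by move=> p; rewrite inE => hp /=; rewrite fg.
apply: eq_integrable fi; first exact: measurable_chart.
by move=> p; rewrite inE => hp /=; rewrite fg.
Qed.

Lemma sphere_integrableD f g : sphere_integrable f -> sphere_integrable g ->
  sphere_integrable (fun p => f p + g p).
Proof.
move=> [fr fi] [gr gi]; split.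
  under eq_fun do rewrite Re_addc.
  exact: (integrableD measurable_chart fr gr).
under eq_fun do rewrite Im_addc.
exact: (integrableD measurable_chart fi gi).
Qed.

Lemma sphere_integralD f g : sphere_integrable f -> sphere_integrable g ->
  sphere_integral (fun p => f p + g p) = sphere_integral f + sphere_integral g.
Proof.
move=> [fr fi] [gr gi]; rewrite !sphere_integralE.
under eq_Rintegral do rewrite Re_addc.
rewrite RintegralD//; last exact: measurable_chart.
under [X in _ +i* X]eq_Rintegral do rewrite Im_addc.
rewrite RintegralD//; exact: measurable_chart.
Qed.

Lemma sphere_integrableZ c f : sphere_integrable f ->
  sphere_integrable (fun p => c * f p).
Proof.
have mC := measurable_chart; move=> [fr fi]; split.
  under eq_fun do rewrite Re_mulc.
  exact: (integrableB mC (integrableZl mC _ fr) (integrableZl mC _ fi)).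
under eq_fun do rewrite Im_mulc.
exact: (integrableD mC (integrableZl mC _ fi) (integrableZl mC _ fr)).
Qed.

Lemma sphere_integralZ c f : sphere_integrable f ->
  sphere_integral (fun p => c * f p) = c * sphere_integral f.
Proof.
move=> [fr fi].
have mC := measurable_chart.
have ifr a := integrableZl mC a fr.
have ifi a := integrableZl mC a fi.
rewrite !sphere_integralE.
under eq_Rintegral do rewrite Re_mulc.
rewrite (RintegralB mC (ifr _) (ifi _)) !RintegralZl//.
under [X in _ +i* X]eq_Rintegral do rewrite Im_mulc.
rewrite (RintegralD mC (ifi _) (ifr _)) !RintegralZl//.
by case: c => a b; apply/eqP; rewrite eq_complex /= !eqxx.
Qed.

Lemma sphere_integral_sum (I : eqType) (r : seq I) (f : I -> R * R -> R[i]) :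
  (forall i, sphere_integrable (f i)) ->
  sphere_integrable (fun p => \sum_(i <- r) f i p) /\
  sphere_integral (fun p => \sum_(i <- r) f i p) = \sum_(i <- r) sphere_integral (f i).
Proof.
move=> fi; elim: r => [|i r [IHi IH]].
  have z : sphere_integrable (fun=> 0 : R[i]).
    by split; exact: integrable0.
  split; first by under eq_fun do rewrite big_nil.
  under eq_fun do rewrite big_nil.
  rewrite big_nil -[RHS](mul0r (sphere_integral (fun=> 0))) -sphere_integralZ//.
  by under [in RHS]eq_fun do rewrite mul0r.
split; under eq_fun do rewrite big_cons; first exact: sphere_integrableD.
by rewrite big_cons sphere_integralD// IH.
Qed.

Lemma sin_cos_2pi k : sin (k%:~R * (2 * pi)) = 0 :> R /\ cos (k%:~R * (2 * pi)) = 1 :> R.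
Proof.
have nat_case (n : nat) : sin (n%:R * (2 * pi)) = 0 :> R /\ cos (n%:R * (2 * pi)) = 1 :> R.
  have -> : n%:R * (2 * pi) = 0 + pi *+ 2 *+ n :> R.
    by rewrite add0r mulr_natl [2 * _]mulr_natl.
  by rewrite (periodicn (@sinD2pi R)) (periodicn (@cosD2pi R)) sin0 cos0.
case: k => n; first exact: nat_case.
by rewrite NegzE intrN mulNr sinN cosN; have [-> ->] := nat_case n.+1; rewrite oppr0.
Qed.

Lemma continuous_scaled (u : R -> R) (a : R) : continuous u -> continuous (fun x => u (a * x)).
Proof.
move=> cu x; apply: (@continuous_comp _ _ _ ( *%R a) u); last exact: cu.
exact: mulrl_continuous.
Qed.

Lemma cis_2pi k : cis (k%:~R * (2 * pi)) = cis (k%:~R * 0) :> R[i].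
Proof. by rewrite /cis mulr0 cos0 sin0; have [-> ->] := sin_cos_2pi k. Qed.

Lemma is_cderive_cis_antiderivative k x : k != 0 ->
  is_cderive (fun t => ('i%C * k%:~R%:C)^-1 * cis (k%:~R * t)) x (cis (k%:~R * x)).
Proof.
move=> k0; have := is_cderive_cis ('i%C * k%:~R%:C)^-1 k%:~R x.
rewrite mulVf ?mul1r// mulf_neq0//; first by rewrite eq_complex /= oner_eq0 andbF.
by rewrite (inj_eq (@complexI R) _ 0) intr_eq0.
Qed.

Lemma integral_cos k :
  \int[lebesgue_measure]_(x in `]0, 2 * pi[) cos (k%:~R * x) = (k == 0)%:R * (2 * pi) :> R.
Proof.
have pi2 : 0 < 2 * pi :> R by rewrite mulr_gt0// pi_gt0.
have cc := continuous_scaled (a := k%:~R) (@continuous_cos R).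
have [k0|k0] := eqVneq k 0.
  have d x : is_derive x 1 id (cos (k%:~R * x)).
    by rewrite k0 mul0r cos0; exact: is_derive_id.
  by rewrite (Rintegral_antiderivative pi2 cc d) subr0 mul1r.
rewrite (Rintegral_antiderivative pi2 cc (fun x => (is_cderive_cis_antiderivative x k0).1)).
by rewrite cis_2pi subrr mul0r.
Qed.

Lemma integral_sin k :
  \int[lebesgue_measure]_(x in `]0, 2 * pi[) sin (k%:~R * x) = 0 :> R.
Proof.
have pi2 : 0 < 2 * pi :> R by rewrite mulr_gt0// pi_gt0.
have cs := continuous_scaled (a := k%:~R) (@continuous_sin R).
have [k0|k0] := eqVneq k 0.
  have d x : is_derive x 1 (cst 0) (sin (k%:~R * x)).
    by rewrite k0 mul0r sin0; exact: is_derive_cst.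
  by rewrite (Rintegral_antiderivative pi2 cs d) subr0.
rewrite (Rintegral_antiderivative pi2 cs (fun x => (is_cderive_cis_antiderivative x k0).2)).
by rewrite cis_2pi subrr.
Qed.

(** Fubini separates the variables, and e^(i k lambda) integrates over a full period to 2 pi if k =
    0 and to 0 otherwise. *)
Lemma sphere_integral_zonal (c : R[i]) k (H : R -> R) : continuous H ->
  sphere_integrable (fun p => c * (H p.2)%:C * cis (k%:~R * p.1)) /\
  sphere_integral (fun p => c * (H p.2)%:C * cis (k%:~R * p.1)) =
  c * ((k == 0)%:R * (2 * pi) * \int[lebesgue_measure]_(x in `](-1), 1[) H x)%:C.
Proof.
move=> cH.
have iH : leb.-integrable `](-1), 1[ (EFin \o H).
  exact: integrable_itv_continuous (@itvoo_sub_itvcc R _ _).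
have ic : leb.-integrable `]0, 2 * pi[ (EFin \o (fun x : R => cos (k%:~R * x))).
  apply: integrable_itv_continuous (@itvoo_sub_itvcc R _ _) => //.
  exact/continuous_scaled/continuous_cos.
have isn : leb.-integrable `]0, 2 * pi[ (EFin \o (fun x : R => sin (k%:~R * x))).
  apply: integrable_itv_continuous (@itvoo_sub_itvcc R _ _) => //.
  exact/continuous_scaled/continuous_sin.
have mA : measurable (`]0, 2 * pi[%classic : set (measurableTypeR R)) by [].
have mB : measurable (`](-1), 1[%classic : set (measurableTypeR R)) by [].
pose h p : R[i] := (H p.2)%:C * cis (k%:~R * p.1).
have Rh p : complex.Re (h p) = cos (k%:~R * p.1) * H p.2 by rewrite /h Re_mulc /= mul0r subr0 mulrC.
have Ih p : complex.Im (h p) = sin (k%:~R * p.1) * H p.2 by rewrite /h Im_mulc /= mul0r addr0 mulrC.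
have hi : sphere_integrable h.
  split.
    under eq_fun do rewrite Rh.
    exact: (integrable_setX_prod mA mB ic iH).
  under eq_fun do rewrite Ih.
  exact: (integrable_setX_prod mA mB isn iH).
have -> : (fun p => c * (H p.2)%:C * cis (k%:~R * p.1)) = (fun p => c * h p).
  by apply/funext => p; rewrite -mulrA.
split; first exact: sphere_integrableZ.
rewrite sphere_integralZ//; congr (_ * _).
rewrite !sphere_integralE.
under [X in X +i* _ = _]eq_Rintegral do rewrite Rh.
under [X in _ +i* X = _]eq_Rintegral do rewrite Ih.
rewrite (Rintegral_setX_prod mA mB ic iH) (Rintegral_setX_prod mA mB isn iH).
by rewrite integral_cos integral_sin mul0r.
Qed.

End sphere_integral.

(** * Orthonormality of the spherical harmonics *)

Section orthonormality.
Variable R : realType.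
Implicit Types (f g : R * R -> R[i]) (F : R -> R) (p : R * R) (a c : R[i]).
Implicit Types (m k : int) (l M : nat) (q : {poly R}) (x : R).

Lemma inner_eq_chart f f' g g' : eq_chart f f' -> eq_chart g g' ->
  inner f g = inner f' g'.
Proof. by move=> ff gg; apply: eq_sphere_integral => p hp; rewrite ff// gg. Qed.

Lemma continuous_radial M q : continuous (radial M q).
Proof.
move=> x.
have cs : {for x, continuous (fun t : R => Num.sqrt (1 - t ^+ 2))}.
  apply: continuous_comp; last exact: sqrt_continuous.
  have -> : (fun t : R => 1 - t ^+ 2) = horner (1 - 'X^2).
    by apply/funext => t; rewrite horner_weight.
  exact: continuous_horner.
have cX : {for x, continuous (fun t : R => Num.sqrt (1 - t ^+ 2) ^+ M)}.
  elim: M => [|M IH]; first exact: cvg_cst.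
  have -> : (fun t : R => Num.sqrt (1 - t ^+ 2) ^+ M.+1) =
            (fun t => Num.sqrt (1 - t ^+ 2) * Num.sqrt (1 - t ^+ 2) ^+ M).
    by apply/funext => t; rewrite exprS.
  exact: (continuousM cs IH).
have cq : {for x, continuous (horner q)} by exact: continuous_horner.
have := continuousM cX cq; exact.
Qed.

Lemma zonal_mul_conj c c' m m' F F' p :
  zonal c m F p * conjc (zonal c' m' F' p) =
  c * conjc c' * ((F \* F') p.2)%:C * cis ((m - m')%:~R * p.1).
Proof.
rewrite /zonal !conjcM conjc_real conj_cis intrB mulrBl cisD /= rmorphM /=; ring.
Qed.

Lemma inner_zonal c c' m m' F F' : continuous F -> continuous F' ->
  sphere_integrable (fun p => zonal c m F p * conjc (zonal c' m' F' p)) /\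
  inner (zonal c m F) (zonal c' m' F') =
  c * conjc c' * ((m == m')%:R * (2 * pi) *
    \int[lebesgue_measure]_(x in `](-1), 1[) (F x * F' x))%:C.
Proof.
move=> cF cF'.
have cFF : continuous (F \* F') by move=> x; exact: (continuousM (cF x) (cF' x)).
rewrite /inner (_ : (fun p => _ * _) =
  (fun p => c * conjc c' * ((F \* F') p.2)%:C * cis ((m - m')%:~R * p.1))).
  by have [H ->] := sphere_integral_zonal (c * conjc c') (m - m') cFF; rewrite subr_eq0.
by apply/funext => p; exact: zonal_mul_conj.
Qed.

Lemma inner_zonal_radial c c' m m' q q' :
  inner (zonal c m (radial `|m| q)) (zonal c' m' (radial `|m'| q')) =
  c * conjc c' * ((m == m')%:R * (2 * pi * weighted_int `|m| q q'))%:C.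
Proof.
have [_ ->] := inner_zonal c c' m m' (@continuous_radial `|m| q) (@continuous_radial `|m'| q').
(* Only for m = m' do the two half-weights combine to (1 - x^2)^|m|; otherwise both sides vanish and
   the weight written on the right is immaterial. *)
congr (_ * _%:C); rewrite -mulrA; have [<-|_] := eqVneq m m'; last by rewrite !mul0r.
congr (_ * (_ * _)); rewrite /weighted_int /pint; apply: eq_Rintegral => x.
rewrite inE => /in_itv_weight w0; rewrite /radial mulrACA -expr2 -exprM mulnC exprM.
by rewrite sqr_sqrtr ?ltW// !hornerM horner_exp horner_weight mulrA.
Qed.

Lemma zonal_cst a : (fun p => a) = zonal a 0 (radial 0 1).
Proof.
apply/funext => p; rewrite /zonal /radial expr0 mul1r hornerC mulr1.
by rewrite mul0r /cis cos0 sin0 mulr1.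
Qed.

(* The additive constant of a stream function is invisible to a derivative in
   lambda: such a derivative has mean zero. *)
Lemma inner_zonal_addcl a b c' m m' q q' :
  inner (zonal (b * m%:~R%:C) m (radial `|m| q)) (fun p => a + zonal c' m' (radial `|m'| q') p) =
  inner (zonal (b * m%:~R%:C) m (radial `|m| q)) (zonal c' m' (radial `|m'| q')).
Proof.
set f := zonal (b * _) _ _; set g := zonal c' _ _.
have c1 := @continuous_radial `|m| q.
have [ig _] := inner_zonal (b * m%:~R%:C) c' m m' c1 (@continuous_radial `|m'| q').
have [ia ea] := inner_zonal (b * m%:~R%:C) a m 0 c1 (@continuous_radial 0 1).
rewrite /inner.
have -> : (fun p => f p * conjc (a + g p)) =
          (fun p => f p * conjc (zonal a 0 (radial 0 1) p) + f p * conjc (g p)).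
  by apply/funext => p; rewrite -zonal_cst -mulrDr -rmorphD.
rewrite sphere_integralD// -[X in X + _]/(inner f _) ea.
(* For m = 0 the explicit factor m is zero; for other m the function is orthogonal to the constant
   [a], which has order 0. *)
by have [->|m0] := eqVneq m 0; rewrite ?mul0r ?mulr0 ?mul0r add0r.
Qed.

Lemma sph_poly_orthonormal l l' m : (`|m| <= l)%N -> (`|m| <= l')%N ->
  2 * pi * weighted_int `|m| (sph_poly R l m) (sph_poly R l' m) = (l == l')%:R.
Proof.
move=> hl hl'; rewrite /sph_poly weighted_intZl weighted_intZr.
have [<-|ll] := eqVneq l l'; last by rewrite rodrigues_orthogonal// !mulr0.
rewrite rodrigues_norm// /sph_norm.
set s := (if _ is Posz _ then _ else _).
set A := (X in Num.sqrt X); set B := 2 ^+ l * l`!%:R.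
have s2 : s * s = 1 by rewrite /s; case: (m) => n; rewrite ?mulr1// -expr2 sqrr_sign.
have pi0 : pi != 0 :> R by rewrite gt_eqF// pi_gt0.
have f1 : (l + `|m|)`!%:R != 0 :> R by rewrite pnatr_eq0 -lt0n fact_gt0.
have f2 : (l - `|m|)`!%:R != 0 :> R by rewrite pnatr_eq0 -lt0n fact_gt0.
have f3 : l`!%:R != 0 :> R by rewrite pnatr_eq0 -lt0n fact_gt0.
have n1 : (2 * l + 1)%:R != 0 :> R by rewrite pnatr_eq0 addn1.
have B0 : B != 0 by rewrite mulf_neq0// expf_neq0// pnatr_eq0.
have A2 : Num.sqrt A * Num.sqrt A = A.
  by rewrite -expr2 sqr_sqrtr// /A !mulr_ge0// ?invr_ge0 ?ler0n// mulr_ge0// pi_ge0.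
set W := _ * (2 / _).
(* The squares are isolated so that the roots disappear; then 2 pi, (2l+1)/(4 pi) and 2/(2l+1)
   multiply to 1, while the factorials and B^2 cancel. *)
transitivity (2 * pi * (s * s) * (Num.sqrt A * Num.sqrt A) / B ^+ 2 * W).
  by field.
rewrite s2 A2 /A /W -[RHS]/1.
move: (_%:R) (_%:R) (_%:R) B {A A2 W f3} n1 f1 f2 B0 => N P Q B n1 f1 f2 B0.
by move: (pi : R) pi0 => D D0; field; rewrite n1 f1 f2 B0 D0.
Qed.

Lemma inner_sph_zonal l l' m m' : (`|m| <= l)%N -> (`|m'| <= l')%N ->
  inner (zonal 1 m (radial `|m| (sph_poly R l m))) (zonal 1 m' (radial `|m'| (sph_poly R l' m'))) =
  ((l, m) == (l', m'))%:R.
Proof.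
move=> hl hl'; rewrite inner_zonal_radial conjc1 mulr1 mul1r xpair_eqE andbC.
have [mm|_] /= := eqVneq m m'; last by rewrite mul0r.
by rewrite -mm in hl' *; rewrite mul1r sph_poly_orthonormal//; case: (l == l').
Qed.

End orthonormality.

(** * Structure constants *)

Section harm_row_sum.
Variables (V : comNzRingType) (m : int) (n : nat) (F : nat * int -> V).

Let row (i : nat) : nat * int := ((`|m| + i)%N, m).

Hypothesis F_row : forall k, harm_index k -> F k != 0 ->
  exists2 i, (i < n)%N & k = row i.

Lemma finite_harm_row : finite_set [set k | harm_index k /\ F k != 0].
Proof.
apply: (@sub_finite_set _ _ (row @` `I_n)); last exact/finite_image/finite_II.
by move=> k [hk Fk]; have [i ni ->] := F_row hk Fk; exists i.
Qed.

(** Applied twice: to the expansion of the bracket in harmonics and to the sum in the final formula,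
    both of which live on the single order m = m1 + m2. *)
Lemma fsbig_harm_row :
  \sum_(k \in harm_index) F k = \sum_(i < n) F (row i).
Proof.
rewrite (fsbig_ord _ n (fun i => F (row i))) -(@fsbig_image _ _ _ _ _ `I_n row F); last first.
  by move=> i j _ _ [/addnI].
apply/esym/fsbig_widen => [k [i _ <-]|k [hk nk]].
  by rewrite /harm_index /= leq_addr.
apply: contrapT => /eqP Fk; apply: nk.
by have [i ni ->] := F_row hk Fk; exists i.
Qed.

End harm_row_sum.

Section structure_constants.
Variable R : realType.
Implicit Types (f g : R * R -> R[i]) (p : R * R) (l : nat) (m : int) (q : {poly R}).

Lemma inner_sph_harm k k' : harm_index k -> harm_index k' ->
  inner (@sph_harm R k.1 k.2) (@sph_harm R k'.1 k'.2) = (k == k')%:R.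
Proof.
case: k k' => [l m] [l' m'] /= hk hk'.
by rewrite (inner_eq_chart (@sph_harm_zonal R l m) (@sph_harm_zonal R l' m')) inner_sph_zonal.
Qed.

Lemma sph_harm_integrable c k k' :
  sphere_integrable (fun p => c * @sph_harm R k.1 k.2 p * conjc (@sph_harm R k'.1 k'.2 p)).
Proof.
have [ig _] := inner_zonal 1 1 k.2 k'.2 (@continuous_radial R `|k.2| (sph_poly R k.1 k.2))
  (@continuous_radial R `|k'.2| (sph_poly R k'.1 k'.2)).
have := sphere_integrableZ c ig; apply: eq_sphere_integrable => p hp.
by rewrite !sph_harm_zonal// mulrA.
Qed.

Lemma inner_sum_sph_harm (s : seq (nat * int)) (G : nat * int -> R[i]) k :
  uniq s -> (forall k', k' \in s -> harm_index k') -> harm_index k ->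
  inner (fun p => \sum_(k' <- s) G k' * @sph_harm R k'.1 k'.2 p) (@sph_harm R k.1 k.2) =
  (k \in s)%:R * G k.
Proof.
move=> us hs hk; rewrite /inner.
under eq_fun do rewrite mulr_suml.
have [_ ->] := sphere_integral_sum s (fun k' => sph_harm_integrable (G k') k' k).
transitivity (\sum_(k' <- s) G k' * (k' == k)%:R).
  apply: eq_big_seq => k' /hs hk'.
  rewrite -inner_sph_harm// /inner -sphere_integralZ.
    by apply: eq_sphere_integral => p _; rewrite mulrA.
  have := sph_harm_integrable 1 k' k; apply: eq_sphere_integrable => p _.
  by rewrite mul1r.
have [ks|ks] := boolP (k \in s).
  rewrite (bigD1_seq k)//= eqxx mulr1 mul1r big1_seq ?addr0// => k' /andP[/negbTE -> _].
  by rewrite mulr0.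
rewrite mul0r big1_seq// => k' /andP[_ k's].
by have [E|_] := eqVneq k' k; rewrite ?mulr0//; rewrite E (negbTE ks) in k's.
Qed.

(** Finite support allows pairing the expansion with Y_k term by term, and orthonormality leaves G
    at k. This pins down the constants that [structure_const] obtains by choice. *)
Lemma structure_const_unique l1 m1 l2 m2 G k :
  is_structure_const l1 m1 l2 m2 G -> harm_index k ->
  G k.1 k.2 =
  inner (poisson (@sph_harm R l1 m1) (@sph_harm R l2 m2)) (@sph_harm R k.1 k.2).
Proof.
move=> [finG GE] hk.
set A := [set _ | _] in finG.
have E : eq_chart (poisson (@sph_harm R l1 m1) (@sph_harm R l2 m2))
  (fun p => \sum_(k' <- fset_set A) G k'.1 k'.2 * @sph_harm R k'.1 k'.2 p).
  move=> p hp; rewrite GE// -fsbig_finite//.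
  apply/esym/fsbig_widen => [k' []//|k' [hk' nA]] /=.
  suff -> : G k'.1 k'.2 = 0 by rewrite mul0r.
  by apply: contrapT => /eqP Gk; apply: nA.
rewrite (inner_eq_chart E (fun p _ => erefl)).
rewrite (@inner_sum_sph_harm _ (fun k => G k.1 k.2)) ?fset_uniq//.
(* Outside the support the pairing gives 0, and G vanishes there as well. *)
- have [|kA] := boolP (k \in _); first by rewrite mul1r.
  rewrite mul0r; apply: contrapT => /eqP Gk; case/negP: kA.
  by rewrite in_fset_set// inE.
- by move=> k'; rewrite in_fset_set// inE => -[].
Qed.

Lemma sph_norm_neq0 l m : @sph_norm R l m != 0.
Proof.
have pi0 : 0 < pi :> R by exact: pi_gt0.
rewrite /sph_norm; apply: mulf_neq0; first apply: mulf_neq0.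
- by case: m => n //; rewrite ?oner_eq0// signr_eq0.
- rewrite gt_eqF// sqrtr_gt0 !mulr_gt0 ?invr_gt0 ?ltr0n ?fact_gt0 ?addn1//.
  by rewrite mulr_gt0.
- by rewrite invr_eq0 mulf_neq0// ?expf_neq0// pnatr_eq0 -lt0n fact_gt0.
Qed.

Lemma sph_poly_span m q : exists n (h : nat -> R),
  q = \sum_(i < n) h i *: sph_poly R (`|m| + i) m.
Proof.
have [n [h ->]] := rodrigues_span `|m| q.
exists n, (fun i => h i / sph_norm R (`|m| + i) m); apply: eq_bigr => i _.
by rewrite /sph_poly scalerA divfK ?sph_norm_neq0.
Qed.

Lemma gegenbauer_opZ M (a : R) q : gegenbauer_op M (a *: q) = a *: gegenbauer_op M q.
Proof. by rewrite /gegenbauer_op !derivZ -!scalerAr -!scalerBr. Qed.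

Lemma gegenbauer_op_sum M n (h : 'I_n -> {poly R}) :
  gegenbauer_op M (\sum_(i < n) h i) = \sum_(i < n) gegenbauer_op M (h i).
Proof.
apply: (big_morph (gegenbauer_op M)) => [p1 p2|].
  by rewrite /gegenbauer_op !derivD; ring.
by rewrite -(scale0r 0) gegenbauer_opZ !scale0r.
Qed.

Lemma gegenbauer_sph_poly l m : (`|m| <= l)%N ->
  gegenbauer_op `|m| (sph_poly R l m) = - (l * l.+1)%:R *: sph_poly R l m.
Proof.
move=> hl; rewrite /sph_poly gegenbauer_opZ gegenbauer_rodrigues//. by rewrite !scalerA mulrC.
Qed.

(* If {Y1, Y2} = i (1 - mu^2)^(|m|/2) q(mu) e^(i m lambda), then
   G^(l m) = i [row_coef m q l]. *)
Definition row_coef m q l : R := 2 * pi * weighted_int `|m| q (sph_poly R l m).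

(** Pairing an expansion of [q] with [sph_poly] identifies its coefficients as [row_coef]. The
    second clause bounds the support, which every finiteness claim below relies on. *)
Lemma row_expansion m q : exists n,
  q = \sum_(i < n) row_coef m q (`|m| + i) *: sph_poly R (`|m| + i) m /\
  forall l, (`|m| <= l)%N -> row_coef m q l != 0 -> (l - `|m| < n)%N.
Proof.
have [n [h qE]] := sph_poly_span m q; exists n.
have gE l : (`|m| <= l)%N ->
    row_coef m q l = if (l - `|m| < n)%N then h (l - `|m|)%N else 0.
  move=> hl; rewrite /row_coef qE weighted_int_suml mulr_sumr.
  transitivity (\sum_(i < n) h i * (`|m| + i == l)%N%:R).
    apply: eq_bigr => i _; rewrite weighted_intZl mulrCA sph_poly_orthonormal//.
    exact: leq_addr.
  case: ltnP => ln.
    rewrite (bigD1 (Ordinal ln)) //= subnKC// eqxx mulr1 big1 ?addr0// => i.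
    rewrite -val_eqE /= => /negbTE il.
    by rewrite (_ : _ == _ = false) ?mulr0//; apply/negbTE; lia.
  rewrite big1// => i _; have := ltn_ord i => hi.
  by rewrite (_ : _ == _ = false) ?mulr0//; apply/negbTE; lia.
split.
  rewrite {1}qE; apply: eq_bigr => i _.
  by rewrite gE ?leq_addr// addKn ltn_ord.
by move=> l hl; rewrite gE//; case: ltnP => //; rewrite eqxx.
Qed.

End structure_constants.

(** * Values of the structure constants for a given bracket *)

Section real_structure_constants.
Variable R : realType.
Variables (l1 l2 : nat) (m1 m2 : int) (q : {poly R}).
Let m := m1 + m2.

Hypothesis poisson_sph : forall c1 c2,
  eq_chart (poisson (zonal c1 m1 (radial `|m1| (sph_poly R l1 m1)))
                    (zonal c2 m2 (radial `|m2| (sph_poly R l2 m2))))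
           (zonal (c1 * c2 * 'i%C) m (radial `|m| q)).

Lemma poisson_sph_harm :
  eq_chart (poisson (@sph_harm R l1 m1) (@sph_harm R l2 m2)) (zonal 'i%C m (radial `|m| q)).
Proof.
move=> p hp; rewrite (poisson_eq_chart (@sph_harm_zonal _ _ _) (@sph_harm_zonal _ _ _) hp).
by rewrite poisson_sph// mulr1 mul1r.
Qed.

Lemma exists_structure_const : exists G : nat -> int -> R[i],
  is_structure_const l1 m1 l2 m2 G.
Proof.
have [n [qE nE]] := row_expansion m q.
pose G l (k : int) : R[i] :=
  if (k == m) && (`|m| <= l)%N then 'i%C * (row_coef m q l)%:C else 0.
have G_row k : harm_index k -> G k.1 k.2 != 0 ->
    exists2 i, (i < n)%N & k = ((`|m| + i)%N, m).
  case: k => l k _; rewrite /G /=; case: ifP => [/andP[/eqP -> lm]|_]; last by rewrite eqxx.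
  rewrite mulf_eq0 negb_or => /andP[_]; rewrite (inj_eq (@complexI R) _ 0) => rl.
  by exists (l - `|m|)%N; rewrite ?nE// subnKC.
exists G; split; first exact: finite_harm_row G_row.
move=> p hp; rewrite poisson_sph_harm//.
rewrite (@fsbig_harm_row _ m n (fun k => G k.1 k.2 * @sph_harm R k.1 k.2 p)); last first.
  by move=> k hk; rewrite mulf_eq0 negb_or => /andP[Gk _]; exact: G_row.
rewrite {1}qE /zonal /radial horner_sum mulr_sumr rmorph_sum mulr_sumr mulr_suml.
apply: eq_bigr => i _ /=; rewrite sph_harm_zonal// /G eqxx leq_addr /=.
by rewrite /zonal /radial hornerZ !rmorphM /=; ring.
Qed.

Lemma structure_constE l k : (`|k| <= l)%N ->
  @structure_const R l1 m1 l2 m2 l k = 'i%C * ((k == m)%:R * row_coef m q l)%:C.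
Proof.
move=> hk; have hG : is_structure_const l1 m1 l2 m2 (@structure_const R l1 m1 l2 m2).
  by apply: xgetPex; exact: exists_structure_const.
rewrite (structure_const_unique (k := (l, k)) hG)//=.
rewrite (inner_eq_chart poisson_sph_harm (@sph_harm_zonal R l k)).
rewrite inner_zonal_radial conjc1 mulr1 eq_sym /row_coef.
by have [->|_] := eqVneq k m; rewrite ?mul0r.
Qed.

Lemma real_complex_signz k : ((-1) ^ k)%:C = (-1) ^ k :> R[i].
Proof. by rewrite fmorphXz rmorphN1. Qed.

Lemma sqr_signz (F : fieldType) k : (-1) ^ k * (-1) ^ k = 1 :> F.
Proof. by case: k => n; rewrite ?NegzE ?exprN -?invfM -expr2 sqrr_sign ?invr1. Qed.

(** Solve i r = -i (-1)^k g for g, using that (-1)^k is its own inverse; a real solution exists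
    because [row_coef] is real. *)
Lemma real_structure_constE l k : (`|k| <= l)%N ->
  @real_structure_const R l1 m1 l2 m2 l (- k) =
  - (-1) ^ k * ((k == m)%:R * row_coef m q l).
Proof.
move=> hk.
have : is_real_structure_const l1 m1 l2 m2 (@real_structure_const R l1 m1 l2 m2).
  apply: xgetPex.
  (* The upper index of g is the opposite of the order m3, hence the sign change of [k] throughout
     the witness. *)
  exists (fun l k => - (-1) ^ (- k) * ((- k == m)%:R * row_coef m q l)) => l3 m3 h3.
  rewrite structure_constE// opprK [in RHS]rmorphM rmorphN /= real_complex_signz.
  have := sqr_signz R[i] m3; move: (_ ^ m3) (_%:C) => s X s2.
  by transitivity ('i%C * X * (s * s)); [rewrite s2 mulr1|ring].
move=> /(_ l k hk); rewrite structure_constE// => E.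
apply: (@complexI R); rewrite [in RHS]rmorphM rmorphN /= real_complex_signz.
have i0 : 'i%C != 0 :> R[i] by rewrite eq_complex /= oner_eq0 andbF.
move: E; rewrite !mulNr -mulrN -!mulrA => /(mulfI i0) ->.
have := sqr_signz R[i] k; move: (_ ^ k) (_%:C) => s X s2.
by transitivity (X * (s * s)); [rewrite s2 mulr1|ring].
Qed.

End real_structure_constants.

(** * The Misiolek criterion *)

Section misiolek.
Variable R : realType.
Implicit Types (f g : R * R -> R[i]) (p : R * R) (m : int) (q : {poly R}).

Lemma poisson_mu f : poisson (@mu_coord R) f = (fun p => - dlambda f p).
Proof.
apply/funext => p; rewrite /poisson.
have -> : dlambda (@mu_coord R) p = 0.
  by rewrite /dlambda /cderive1 /mu_coord /= !derive1_cst.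
have -> : dmu (@mu_coord R) p = 1.
  apply: is_cderiveE; have := is_cderive_real 1 (is_derive_id p.2 (1 : R)).
  by rewrite mulr1; apply: near_is_cderive; near=> t; rewrite mulr1.
by rewrite mul0r mul1r sub0r.
Unshelve. all: by end_near. Qed.

(** The factor m stays separate in the coefficient, the shape in which [inner_zonal_addcl] discards
    the constant of a stream function. *)
Lemma poisson_mu_zonal c m q :
  poisson (@mu_coord R) (zonal c m (radial `|m| q)) =
  zonal (- (c * 'i%C) * m%:~R%:C) m (radial `|m| q).
Proof.
rewrite poisson_mu dlambda_zonal; apply/funext => p.
by rewrite /zonal !mulNr !mulrA.
Qed.

Lemma eq_chart_trans f g h : eq_chart f g -> eq_chart g h -> eq_chart f h.
Proof. by move=> fg gh p hp; rewrite fg// gh. Qed.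

Variables (l1 l2 : nat) (m1 m2 : int) (q : {poly R}).
Let m := m1 + m2.
Let y1 := sph_poly R l1 m1.
Let y2 := sph_poly R l2 m2.
Let f := stream_function (@sph_field R l1 m1).
Let g := stream_function (@sph_field R l2 m2).

Hypothesis poisson_sph : forall c1 c2,
  eq_chart (poisson (zonal c1 m1 (radial `|m1| y1)) (zonal c2 m2 (radial `|m2| y2)))
           (zonal (c1 * c2 * 'i%C) m (radial `|m| q)).
Hypotheses (hm1 : (`|m1| <= l1)%N) (hm2 : (`|m2| <= l2)%N).

Let fg : eq_chart (poisson f g) (zonal 'i%C m (radial `|m| q)).
Proof.
have [c1 hf] := stream_function_sph_field R l1 m1.
have [c2 hg] := stream_function_sph_field R l2 m2.
apply: eq_chart_trans (poisson_eq_chart hf hg) _.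
by rewrite poisson_addcl => p hp; rewrite poisson_sph// !mul1r.
Qed.

Let i_conj : 'i%C * conjc 'i%C = 1 :> R[i].
Proof. by apply/eqP; rewrite eq_complex /=; apply/andP; split; apply/eqP; ring. Qed.

Lemma inner_laplacian_poisson :
  inner (laplacian (poisson f g)) (poisson f g) =
  (2 * pi * weighted_int `|m| (gegenbauer_op `|m| q) q)%:C.
Proof.
have hl : eq_chart (laplacian (poisson f g)) (zonal 'i%C m (radial `|m| (gegenbauer_op `|m| q))).
  exact: eq_chart_trans (laplacian_eq_chart fg) (laplacian_zonal _ _ _).
by rewrite (inner_eq_chart hl fg) inner_zonal_radial i_conj mul1r eqxx mul1r.
Qed.

Lemma inner_poisson_laplacian :
  inner (poisson (laplacian f) g) (poisson f g) =
  (- (l1 * l1.+1)%:R * (2 * pi * weighted_int `|m| q q))%:C.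
Proof.
set k := - (l1 * l1.+1)%:R.
have [c1 hf] := stream_function_sph_field R l1 m1.
have [c2 hg] := stream_function_sph_field R l2 m2.
(* The leading 0 makes the function match [poisson_addcl], which removes the constant of [g] at the
   same time. *)
have hlf : eq_chart (laplacian f) (fun p => 0 + zonal k%:C m1 (radial `|m1| y1) p).
  apply: eq_chart_trans (laplacian_eq_chart hf) _.
  rewrite laplacian_addcl => p hp; rewrite laplacian_zonal// gegenbauer_sph_poly// -/k.
  by rewrite add0r /zonal radialZ rmorphM mul1r.
have hp : eq_chart (poisson (laplacian f) g) (zonal (k%:C * 'i%C) m (radial `|m| q)).
  apply: eq_chart_trans (poisson_eq_chart hlf hg) _.
  by rewrite poisson_addcl => p hp; rewrite poisson_sph// mulr1.
rewrite (inner_eq_chart hp fg) inner_zonal_radial -[k%:C * _ * _]mulrA i_conj mulr1 eqxx mul1r.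
by rewrite [in RHS]rmorphM.
Qed.

Lemma inner_mu_stream :
  inner (poisson (@mu_coord R) f) g =
  - 'i%C * (m1%:~R * (m1 == m2)%:R * (l1 == l2)%:R)%:C.
Proof.
have [c1 hf] := stream_function_sph_field R l1 m1.
have [c2 hg] := stream_function_sph_field R l2 m2.
have hmu : eq_chart (poisson (@mu_coord R) f)
    (zonal (- (1 * 'i%C) * m1%:~R%:C) m1 (radial `|m1| y1)).
  rewrite -poisson_mu_zonal; apply: eq_chart_trans (poisson_eq_chart (fun p _ => erefl) hf) _.
  by rewrite !poisson_mu dlambda_addcl.
rewrite (inner_eq_chart hmu hg) inner_zonal_addcl inner_zonal_radial conjc1 mulr1 mul1r.
rewrite -mulrA -rmorphM; congr (_ * _%:C); rewrite -[RHS]mulrA; congr (_ * _).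
have [mm|_] := eqVneq m1 m2; last by rewrite !mul0r.
by rewrite !mul1r /y1 /y2 -mm sph_poly_orthonormal// mm.
Qed.

Lemma inner_mu_poisson :
  inner (poisson (@mu_coord R) (poisson f g)) g =
  (m2%:~R * (m2 == m)%:R * row_coef m q l2)%:C.
Proof.
have [c2 hg] := stream_function_sph_field R l2 m2.
have hmu : eq_chart (poisson (@mu_coord R) (poisson f g))
    (zonal (- ('i%C * 'i%C) * m%:~R%:C) m (radial `|m| q)).
  by rewrite -poisson_mu_zonal; exact: poisson_eq_chart (fun p _ => erefl) fg.
rewrite (inner_eq_chart hmu hg) inner_zonal_addcl inner_zonal_radial conjc1 mulr1.
rewrite -expr2 sqr_i opprK mul1r -rmorphM; congr (_%:C).
have [mm|_] := eqVneq m2 m; last by rewrite !mul0r !mulr0 ?mul0r.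
by rewrite /row_coef -mm mul1r mulr1.
Qed.

End misiolek.

Theorem proposition4p1 (R : realType) (l1 l2 : nat) (m1 m2 : int) (a b : R)
    (hl1 : (1 <= l1)%N) (hl2 : (1 <= l2)%N)
    (hm1 : (`|m1| <= l1)%N) (hm2 : (`|m2| <= l2)%N) :
  let g := @real_structure_const R l1 m1 l2 m2 in
  let term := fun k : nat * int =>
    g k.1 (- k.2) ^+ 2 * ((l1 * (l1 + 1))%:R - (k.1 * (k.1 + 1))%:R) in
  finite_set [set k | harm_index k /\ term k != 0] /\
  misiolek_coriolis (@sph_field R l1 m1, a) (@sph_field R l2 m2, b) =
  (\sum_(k \in harm_index) term k
   - m1%:~R ^+ 2 * (m1 == m2)%:R * (l1 == l2)%:R
   + (- 1) ^ m2 * a * m2%:~R * g l2 (- m2))%:C.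
Proof.
move=> g term; pose m := m1 + m2.
have [q hq] := poisson_zonal_radial m1 m2 (sph_poly R l1 m1) (sph_poly R l2 m2).
have [n [qE nE]] := row_expansion m q.
pose r i := row_coef m q (`|m| + i).
(* Squaring removes the sign -(-1)^m3 that separates g from [row_coef]. *)
have termE k : harm_index k -> term k =
    (k.2 == m)%:R * (row_coef m q k.1 ^+ 2 * ((l1 * (l1 + 1))%:R - (k.1 * (k.1 + 1))%:R)).
  move=> hk; rewrite /term /g (real_structure_constE hq)// mulNr sqrrN 2!exprMn.
  rewrite [((-1) ^ _) ^+ 2]expr2 sqr_signz mul1r -mulrA.
  by case: (k.2 == m); rewrite ?expr1n ?expr0n /= ?mul0r.
have term_row k : harm_index k -> term k != 0 ->
    exists2 i, (i < n)%N & k = ((`|m| + i)%N, m).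
  move=> hk; rewrite termE//; case: k hk => l k /= hk.
  have [km|_] := eqVneq k m; last by rewrite mul0r eqxx.
  rewrite km /harm_index /= in hk *; rewrite mul1r mulf_eq0 expf_eq0 /= negb_or => /andP[rl _].
  by exists (l - `|m|)%N; rewrite ?nE// subnKC.
split; first exact: finite_harm_row term_row.
rewrite (fsbig_harm_row term_row).
have E1 := inner_laplacian_poisson hq.
have E2 := inner_poisson_laplacian hq hm1.
have E3 := @inner_mu_stream R _ _ _ _ hm1 hm2.
have E4 := inner_mu_poisson hq.
have cmb (x1 x2 x3 x4 z1 z2 z3 z4 : R[i]) : x1 = z1 -> x2 = z2 -> x3 = z3 -> x4 = z4 ->
    x1 - x2 - `|x3| ^+ 2 - a%:C * x4 = z1 - z2 - `|z3| ^+ 2 - a%:C * z4.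
  by move=> -> -> -> ->.
apply: etrans (cmb _ _ _ _ _ _ _ _ E1 E2 E3 E4) _.
rewrite /g (real_structure_constE hq)//.
(* The modulus forgets -i, and Kronecker deltas equal their squares. *)
have -> : `|- 'i%C * (m1%:~R * (m1 == m2)%:R * (l1 == l2)%:R)%:C| ^+ 2 =
    (m1%:~R ^+ 2 * (m1 == m2)%:R * (l1 == l2)%:R)%:C :> R[i].
  rewrite -add_Re2_Im2 Re_mulc Im_mulc /= oppr0 !mul0r !mulr0 !subrr.
  by case: eqP => _; case: eqP => _ /=; congr (_%:C); ring.
rewrite -!(rmorphM, rmorphB, rmorphD) /=; congr (_%:C).
(* Parseval: [q] is expanded in one slot of each pairing, and the other slot turns into the same
   coefficient r_i, so each term becomes r_i^2 times a difference of eigenvalues. *)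
have -> : \sum_(i < n) term ((`|m| + i)%N, m) =
   2 * pi * weighted_int `|m| (gegenbauer_op `|m| q) q
   - - (l1 * l1.+1)%:R * (2 * pi * weighted_int `|m| q q).
  have hr i p : weighted_int `|m| (r i *: p) q = r i * weighted_int `|m| q p.
    by rewrite weighted_intZl weighted_intC.
  rewrite {1}qE gegenbauer_op_sum [X in _ * (2 * pi * weighted_int _ X _)]qE.
  rewrite !weighted_int_suml !mulr_sumr -sumrB; apply: eq_bigr => i _.
  rewrite gegenbauer_opZ gegenbauer_sph_poly ?leq_addr// -/(r i) !hr weighted_intZr.
  rewrite termE /harm_index /= ?leq_addr// eqxx mul1r -/(r i) !addn1.
  have -> : r i = 2 * pi * weighted_int `|m| q (sph_poly R (`|m| + i) m) by [].
  ring.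
have := sqr_signz R m2; move: ((-1) ^ m2) => s s2.
rewrite -/m; congr (_ + _); set x := row_coef m q l2.
(* The (-1)^m2 of the statement meets the one inside g; their product is 1, and the minus sign in g
   is that of the Coriolis term. *)
by transitivity (- (s * s) * (a * (m2%:~R * (m2 == m)%:R * x))); [rewrite s2 mulN1r|ring].
Qed.
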